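(* Let $X$ be an irreducible shift of finite type and $Y$ an irreducible sofic shift. Let $\pi\colon X \to Y$ be a finite-to-one factor code, let $f\colon Y \to \mathbb{R}$ be a potential with summable variation, that is, $f \in \mathrm{SV}(Y)$, and let $\mu$ be a $\sigma$-invariant Gibbs measure for $f \circ \pi$. Then $\nu = \pi_* \mu$ is a Gibbs measure for $f$.
   Context: A shift space is a closed subset $X\subseteq \mathcal{A}^{\mathbb{Z}}$ ($\mathcal{A}$ a finite discrete alphabet, product topology) that is invariant under the shift $\sigma$, $(\sigma^n x)_0=x_n$. $\mathcal{B}(X)$ is the set of finite words appearing in points of $X$. A shift of finite type is a shift space consisting of all points of $\mathcal{A}^{\mathbb{Z}}$ in which no word from some finite set of forbidden words appears. A factor code $\pi\colon X\to Y$ is a surjective continuous shift-equivariant map between shift spaces; it is finite-to-one if every point of $Y$ has finitely many preimages. A sofic shift is a shift space that is the image of a shift of finite type under a factor code. $X$ is irreducible if for all $u,v\in\mathcal{B}(X)$ there is $w\in\mathcal{B}(X)$ with $uwv\in\mathcal{B}(X)$. All measures are Borel probability measures. Gibbs relation: $\mathfrak{T}_X=\{(x,y)\in X\times X : x_n=y_n \text{ for all } n \text{ with } |n|>N, \text{ for some } N\ge 1\}$. A holonomy of $\mathfrak{T}_X$ is a Borel isomorphism $\psi\colon A\to B$ between Borel sets $A,B\subseteq X$ with $(x,\psi(x))\in\mathfrak{T}_X$ for all $x\in A$. A measure $\mu$ is $\mathfrak{T}_X$-nonsingular if for every Borel $A$ with $\mu(A)=0$, the saturation $\mathfrak{T}_X(A)=\{x'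 : \exists x\in A,\ (x,x')\in\mathfrak{T}_X\}$ has $\mu(\mathfrak{T}_X(A))=0$. A cocycle is a Borel function $\phi\colon\mathfrak{T}_X\to\mathbb{R}$ with $\phi(x,y)+\phi(y,z)=\phi(x,z)$ whenever $(x,y),(y,z)\in\mathfrak{T}_X$. A measure $\mu$ on $X$ is a Gibbs measure for the cocycle $\phi$ if it is $\mathfrak{T}_X$-nonsingular and for every holonomy $\psi\colon A\to B$ of $\mathfrak{T}_X$, $\frac{d(\mu\circ\psi)}{d\mu}(x)=\exp(\phi(x,\psi(x)))$ for $\mu$-a.e. $x\in A$, where $(\mu\circ\psi)(E)=\mu(\psi(E))$ for Borel $E\subseteq A$. Potentials: for continuous $f\colon X\to\mathbb{R}$ put $v_k(f)=\sup\{|f(x)-f(y)| : x_{[-k,k]}=y_{[-k,k]}\}$ for $k\ge 0$ and $v_{-1}(f)=\|f\|_\infty$. $\mathrm{SV}(X)$ is the set of continuous $f$ with $\sum_{k=0}^\infty v_{k-1}(f)<\infty$. For $f\in\mathrm{SV}(X)$ the absolutely convergent series $\phi_f(x,y)=\sum_{n\in\mathbb{Z}}[f(\sigma^n y)-f(\sigma^n x)]$ defines a cocycle on $\mathfrak{T}_X$; a Gibbs measure for $f$ means a Gibbs measure for $\phi_f$. (If $f\in\mathrm{SV}(Y)$ and $\pi\colon X\to Y$ is a factor code then $f\circ\pi\in\mathrm{SV}(X)$.) *)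

(* Defs.v *)
From HB Require Import structures.
From mathcomp Require Import all_boot all_order all_algebra.
From mathcomp Require Import all_classical all_reals all_analysis.
From mathcomp Require Import measurable_realfun.

Set Implicit Arguments.
Unset Strict Implicit.
Unset Printing Implicit Defensive.

Import Order.TTheory GRing.Theory Num.Theory.
Import numFieldNormedType.Exports.

Local Open Scope classical_set_scope.
Local Open Scope ring_scope.

Notation fullShift A := (prod_topology (fun _ : int => discrete_topology A)).

Definition full_shift (A : finType) (n : int) (x : fullShift A) : fullShift A :=
  fun m => x (m + n).

(* Nonemptiness is part of the structure because measurable types are pointed
   in the library; a space carrying a probability measure is nonempty anyway. *)
Record shiftSpace (A : finType) := ShiftSpace {
  shift_set : set (fullShift A);
  shift_closed : closed shift_set;
  shift_inv : forall (n : int) x, shift_set x -> shift_set (full_shift n x);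
  shift_nonempty : shift_set !=set0 }.

Definition points (A : finType) (X : shiftSpace A) : Type :=
  set_type (shift_set X).
Coercion points : shiftSpace >-> Sortclass.

HB.instance Definition _ (A : finType) (X : shiftSpace A) :=
  Topological.copy (points X) (set_type (shift_set X)).

Lemma points_inhabited (A : finType) (X : shiftSpace A) :
  exists _ : points X, True.
Proof.
by have [x Xx] := shift_nonempty X; exists (exist _ x (mem_set Xx)).
Qed.

HB.instance Definition _ (A : finType) (X : shiftSpace A) :=
  isPointed.Build (points X) (sval (cid (points_inhabited X))).

Definition seq_of (A : finType) (X : shiftSpace A) (x : X) : fullShift A :=
  set_val x.

Definition shift_map (A : finType) (X : shiftSpace A) (n : int) (x : X) : X :=
  exist _ (full_shift n (seq_of x))
    (mem_set (@shift_inv _ X n _ (set_mem (svalP x)))).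

Notation borel X := (g_sigma_algebraType (open : set (set (points X)))).

Definition occurs (A : finType) (w : seq A) (x : fullShift A) : Prop :=
  exists i : int, w = mkseq (fun j : nat => x (i + j%:Z)) (size w).

Definition language (A : finType) (X : shiftSpace A) : set (seq A) :=
  [set w | exists x : X, occurs w (seq_of x)].

Definition irreducible (A : finType) (X : shiftSpace A) : Prop :=
  forall u v, language X u -> language X v ->
    exists2 w, language X w & language X (u ++ w ++ v).

Definition finite_type (A : finType) (X : shiftSpace A) : Prop :=
  exists F : seq (seq A),
    shift_set X = [set x | forall w, w \in F -> ~ occurs w x].

Record factorCode (A B : finType) (X : shiftSpace A) (Y : shiftSpace B) :=
  FactorCode {
    factor_fun :> X -> Y;
    factor_continuous : continuous factor_fun;
    factor_surjective : forall y, exists x, factor_fun x = y;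
    factor_equivariant :
      forall x, factor_fun (shift_map 1 x) = shift_map 1 (factor_fun x) }.

Definition finite_to_one (A B : finType) (X : shiftSpace A) (Y : shiftSpace B)
    (pi : factorCode X Y) : Prop :=
  forall y : Y, finite_set (pi @^-1` [set y]).

Definition sofic (B : finType) (Y : shiftSpace B) : Prop :=
  exists (A : finType) (X : shiftSpace A),
    finite_type X /\ inhabited (factorCode X Y).

Lemma factor_measurable (A B : finType) (X : shiftSpace A) (Y : shiftSpace B)
    (pi : factorCode X Y) :
  measurable_fun [set: borel X] (pi : borel X -> borel Y).
Proof.
apply: (@measurability _ _ (borel X) (borel Y) setT _
  (open : set (set (points Y)))) => //.
move=> _ [U oU <-]; rewrite setTI; apply: sub_sigma_algebra.
by move: U oU; apply/continuousP; exact: factor_continuous.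
Qed.

Definition factor_mfun (A B : finType) (X : shiftSpace A) (Y : shiftSpace B)
    (pi : factorCode X Y) : {mfun borel X >-> borel Y} :=
  HB.pack (factor_fun pi : borel X -> borel Y)
    (isMeasurableFun.Build _ _ (borel X) (borel Y) (factor_fun pi)
      (factor_measurable pi)).

Definition factor_image (R : realType) (A B : finType) (X : shiftSpace A)
    (Y : shiftSpace B) (pi : factorCode X Y) (mu : probability (borel X) R) :
    probability (borel Y) R :=
  distribution mu (factor_mfun pi).

Definition shift_invariant (R : realType) (A : finType) (X : shiftSpace A)
    (mu : probability (borel X) R) : Prop :=
  forall E : set (borel X), measurable E -> mu (shift_map 1 @^-1` E) = mu E.

Definition gibbs_rel (A : finType) (X : shiftSpace A) (x y : X) : Prop :=
  exists2 N : nat, (1 <= N)%N &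
    forall n : int, (N < `|n|)%N -> seq_of x n = seq_of y n.

Definition saturation (A : finType) (X : shiftSpace A) (E : set X) : set X :=
  [set x' | exists2 x, E x & gibbs_rel x x'].

(* A holonomy E -> F is represented by a function psi on X, of which only the
   restriction to E matters; psi' is the inverse F -> E. *)
Definition holonomy (A : finType) (X : shiftSpace A) (E F : set (borel X))
    (psi : borel X -> borel X) : Prop :=
  [/\ measurable E, measurable F,
      exists psi' : borel X -> borel X,
        [/\ set_fun E F psi, set_fun F E psi',
            {in E, cancel psi psi'}, {in F, cancel psi' psi} &
            measurable_fun E psi /\ measurable_fun F psi'] &
      forall x, E x -> gibbs_rel x (psi x)].

Definition nonsingular (R : realType) (A : finType) (X : shiftSpace A)
    (mu : probability (borel X) R) : Prop :=
  forall E : set (borel X), measurable E -> mu E = 0%E ->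
    mu (saturation E) = 0%E.

(* g is (a version of) the Radon-Nikodym derivative d lam / d mu on D, where
   lam is a set function on the measurable subsets of D. *)
Definition is_RN_derivative (R : realType) d (T : measurableType d)
    (D : set T) (lam : set T -> \bar R) (mu : {measure set T -> \bar R})
    (g : T -> \bar R) : Prop :=
  [/\ measurable_fun D g, forall x, D x -> (0 <= g x)%E &
      forall E, measurable E -> E `<=` D -> lam E = (\int[mu]_(x in E) g x)%E].

(* phi only matters on pairs in the Gibbs relation. *)
Definition gibbs_measure (R : realType) (A : finType) (X : shiftSpace A)
    (phi : X -> X -> R) (mu : probability (borel X) R) : Prop :=
  nonsingular mu /\
  forall (E F : set (borel X)) (psi : borel X -> borel X), holonomy E F psi ->
    exists2 g : borel X -> \bar R,
      is_RN_derivative E (fun G => mu (psi @` G)) mu g &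
      {ae mu, forall x, E x -> g x = (expR (phi x (psi x)))%:E}.

(* potential_var f k is v_(k-1)(f); potential_var f 0 is the sup norm of f. *)
Definition potential_var (R : realType) (A : finType) (X : shiftSpace A)
    (f : X -> R) (k : nat) : \bar R :=
  if k is k'.+1 then
    ereal_sup [set r | exists x y : X,
      (forall n : int, (`|n| <= k')%N -> seq_of x n = seq_of y n) /\
      r = `|f x - f y|%:E]
  else ereal_sup [set r | exists x : X, r = `|f x|%:E].

Definition summable_variation (R : realType) (A : finType) (X : shiftSpace A)
    (f : X -> R) : Prop :=
  continuous f /\ (\sum_(0 <= k <oo) potential_var f k < +oo)%E.

(* A two-sided series is the sum of its n >= 0 part and its n < 0 part. *)
Definition sumZ (R : realType) (a : int -> R) : R :=
  limn (series (fun k : nat => a k%:Z)) +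
  limn (series (fun k : nat => a (- (k.+1)%:Z))).

Definition potential_cocycle (R : realType) (A : finType) (X : shiftSpace A)
    (f : X -> R) (x y : X) : R :=
  sumZ (fun n => f (shift_map n y) - f (shift_map n x)).

Definition gibbs_for_potential (R : realType) (A : finType) (X : shiftSpace A)
    (f : X -> R) (mu : probability (borel X) R) : Prop :=
  gibbs_measure (potential_cocycle f) mu.

(* Main.v *)
(* Let nu = pi_* mu.  Two points of Y in the same Gibbs class need not lift to
   points of X in the same Gibbs class (their lifts may differ on a half-line),
   so the Gibbs property of nu is not simply pushed forward.  It is obtained in
   two stages.

   First, nu is Gibbs up to a constant c: nu F <= c e^a nu E for every holonomy
   E -> F whose cocycle is at most a.  For this, a point of X over a word of Y
   is modified, using irreducibility and bounded connecting words, into a point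
   over a competing word; as pi is finite-to-one, X has no diamonds and only
   boundedly many preimages of a word are involved.  The connecting words may
   force a bounded translation of the inserted block because X may be periodic,
   and this is where the invariance of mu is used.  Summable variation makes
   all the constants independent of the length of the words.

   Second, c can be improved to every t > sqrt c, hence to 1.  Otherwise some
   holonomy E -> H satisfies nu (psi G) >= t e^a nu G for all G in E, and then
   holonomies starting from H, or from the shift-invariant set spanned by H,
   obey the bound with c / t.  A shift-invariant set agrees, up to a null set,
   with a set saturated for the Gibbs relation (approximate it by clopen sets
   and shift these far away), so this applies to psi itself and yields
   nu H <= c / t^2 nu H.  Bounds with constant 1 for a holonomy and its inverse
   give the Radon-Nikodym derivative. *)
From HB Require Import structures.
Require Import Defs.
From mathcomp Require Import all_boot all_order all_algebra.
From mathcomp Require Import all_classical all_reals all_analysis.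
From mathcomp Require Import measurable_realfun.
From mathcomp Require Import zify lra ring.

Set Implicit Arguments.
Unset Strict Implicit.
Unset Printing Implicit Defensive.

Import Order.TTheory GRing.Theory Num.Theory.
Import numFieldNormedType.Exports.

Local Open Scope classical_set_scope.
Local Open Scope ring_scope.

(** * Cylinders and window sets *)

Definition agree (A : finType) (n : nat) (x y : fullShift A) : Prop :=
  forall m : int, (`|m| <= n)%N -> x m = y m.

Section FullShift.
Variable A : finType.
Implicit Types x y z : fullShift A.

Lemma agree_refl n x : agree n x x. Proof. by []. Qed.

Lemma agree_sym n x y : agree n x y -> agree n y x.
Proof. by move=> h m /h. Qed.

Lemma agree_trans n x y z : agree n x y -> agree n y z -> agree n x z.
Proof. by move=> h k m mn; rewrite h// k. Qed.

Lemma agreeW n k x y : (k <= n)%N -> agree n x y -> agree k x y.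
Proof. by move=> kn h m mk; apply: h; exact: leq_trans kn. Qed.

(** The filter generated by the windows around [x] converges in every coordinate, hence in the
    product topology, the supremum of the coordinate topologies. *)
Lemma nbhs_agree x (U : set (fullShift A)) :
  nbhs x U -> exists n, [set y | agree n x y] `<=` U.
Proof.
pose F := filter_from [set: nat] (fun n => [set y | agree n x y]).
have FF : Filter F.
  apply: filter_from_filter; first by exists 0%N.
  move=> i j _ _; exists (maxn i j) => // y /= xy.
  by split; apply: agreeW xy; rewrite ?leq_maxl ?leq_maxr.
suff : F --> x by move=> /(_ U) /[apply] -[n _ nU]; exists n.
apply/cvg_sup => i V; rewrite nbhsE /= => -[B [[C oC CB] Bx] BV].
exists `|i|%N => // y /= xy; apply: BV; move: Bx; rewrite -CB /=.
by rewrite -(xy i).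
Qed.

Lemma coord_open (m : int) (a : A) : open [set y : fullShift A | y m = a].
Proof.
rewrite (_ : [set y | _ ] = (proj m : fullShift A -> _) @^-1` [set a]) //.
apply: open_comp; last exact: discrete_open.
by move=> y _; exact: (@proj_continuous int (fun=> discrete_topology A) m y).
Qed.

Lemma agree_open n x : open [set y | agree n x y].
Proof.
elim: n => [|n IHn].
  rewrite (_ : [set y | _] = [set y | y 0 = x 0]); first exact: coord_open.
  apply/seteqP; split=> y /= h; first by rewrite h.
  by move=> m m0; rewrite (_ : m = 0) //; lia.
rewrite (_ : [set y | _] = [set y | agree n x y] `&`
   ([set y | y n.+1%:Z = x n.+1%:Z] `&` [set y | y (- n.+1%:Z) = x (- n.+1%:Z)])).
  by apply: openI => //; apply: openI; exact: coord_open.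
apply/seteqP; split=> y /=.
  by move=> h; split; [exact: agreeW h|split; rewrite h//; lia].
move=> [h [h1 h2]] m mn; have [mn'|mn'] := leqP `|m| n; first exact: h.
have [->|->] : m = n.+1%:Z \/ m = - n.+1%:Z by lia.
  exact/esym.
exact/esym.
Qed.

End FullShift.

Section ShiftSpace.
Variables (A : finType) (X : shiftSpace A).
Implicit Types x y z : X.

Lemma seq_of_inj : injective (@seq_of A X).
Proof. by move=> x y; exact: val_inj. Qed.

Lemma mem_seq_of x : shift_set X (seq_of x).
Proof. by have := svalP x; rewrite inE. Qed.

Lemma point_of (u : fullShift A) : shift_set X u -> exists x, seq_of x = u.
Proof. by move=> Xu; exists (exist _ u (mem_set Xu)). Qed.

Lemma closure_agree (u : fullShift A) :
  (forall n, exists x, agree n u (seq_of x)) -> shift_set X u.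
Proof.
move=> h; apply: contrapT => nXu.
have : nbhs u (~` shift_set X).
  by apply: open_nbhs_nbhs; split=> //; apply: closed_openC; exact: shift_closed.
move=> /nbhs_agree[n]; have [x ux] := h n => /(_ _ ux); apply.
exact: mem_seq_of.
Qed.

Definition cyl (n : nat) x : set X := [set y | agree n (seq_of x) (seq_of y)].

(** These are the clopen sets that depend only on the coordinates in [[-n, n]]. Measurability and
    approximation are always checked on them. *)
Definition window_set (n : nat) (S : set X) : Prop :=
  forall x y, agree n (seq_of x) (seq_of y) -> S x -> S y.

Lemma window_cyl n x : window_set n (cyl n x).
Proof. by move=> y z yz xy; exact: agree_trans yz. Qed.

Lemma window_setC n S : window_set n S -> window_set n (~` S).
Proof. by move=> h x y xy nSx /(h _ _ (agree_sym xy)). Qed.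

Lemma open_cyl n x : open (cyl n x).
Proof. by exists [set y | agree n (seq_of x) y] => //; exact: agree_open. Qed.

Lemma open_window n S : window_set n S -> open S.
Proof.
move=> hS; rewrite (_ : S = \bigcup_(x in S) cyl n x).
  by apply: bigcup_open => x _; exact: open_cyl.
apply/seteqP; split=> x; first by move=> Sx; exists x.
by move=> [y Sy yx]; exact: hS yx Sy.
Qed.

Lemma open_sub_cyl (U : set X) x : open U -> U x -> exists n, cyl n x `<=` U.
Proof.
move=> [V oV <-] Vx.
have /nbhs_agree[n nV] : nbhs (seq_of x) V by exact: open_nbhs_nbhs.
by exists n => y /nV.
Qed.

(** The largest window set of radius [n] inside [U]; for open [U] it increases to [U] with [n]. *)
Definition inner (n : nat) (U : set X) : set X := [set x | cyl n x `<=` U].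

Lemma window_inner n U : window_set n (inner n U).
Proof.
by move=> x y xy xU z yz; apply: xU; exact: agree_trans yz.
Qed.

Lemma inner_sub n U : inner n U `<=` U.
Proof. by move=> x; apply; exact: agree_refl. Qed.

Lemma innerW n k U : (k <= n)%N -> inner k U `<=` inner n U.
Proof. by move=> kn x h y /(agreeW kn); exact: h. Qed.

Lemma bigcup_inner U : open U -> \bigcup_n inner n U = U.
Proof.
move=> oU; apply/seteqP; split=> x; first by move=> [n _ /inner_sub].
by move=> /(open_sub_cyl oU)[n nU]; exists n.
Qed.

Lemma measurable_open (U : set (borel X)) : open (U : set X) -> measurable U.
Proof. exact: sub_sigma_algebra. Qed.

Lemma measurable_window n (S : set (borel X)) : window_set n S -> measurable S.
Proof. by move=> /open_window; exact: measurable_open. Qed.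

Lemma closed_window n S : window_set n S -> closed S.
Proof. by move=> /window_setC/open_window/open_closedC; rewrite setCK. Qed.

Lemma measurable_coord (m : int) (a : A) :
  measurable ([set x | seq_of x m = a] : set (borel X)).
Proof. by apply: (@measurable_window `|m|) => x y xy /= <-; rewrite xy. Qed.

(** Every open set is a countable union of window sets, so these suffice as test sets. *)
Lemma measurable_fun_window d (T : measurableType d) (D : set T)
    (g : T -> borel X) : measurable D ->
  (forall n S, window_set n S -> measurable (D `&` g @^-1` S)) ->
  measurable_fun D g.
Proof.
move=> mD h; apply: (@measurability _ _ T (borel X) D g
  (open : set (set (points X)))) => //.
move=> _ [U oU <-]; rewrite -(bigcup_inner oU) preimage_bigcup setI_bigcupr.
by apply: bigcup_measurable => n _; apply: h; exact: window_inner.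
Qed.

Lemma measurable_continuous (R : realType) (g : X -> R) :
  continuous g -> measurable_fun [set: borel X] (g : borel X -> R).
Proof.
move=> cg; apply: (measurability _ (RGenOInfty.measurableE R)) => //.
move=> _ [_ [x ->] <-]; rewrite setTI; apply: measurable_open.
by apply: open_comp; [move=> y _; exact: cg|exact: interval_open].
Qed.

End ShiftSpace.

(** * Regularity and block codes *)

Section Regularity.
Variables (R : realType).

(** The differences decrease to the empty set, and a finite measure is continuous from above. *)
Lemma bigcup_approx d (T : measurableType d) (P : probability T R)
    (K : (set T)^nat) (e : R) :
  (forall n, measurable (K n)) -> {homo K : n m / (n <= m)%N >-> n `<=` m} ->
  0 < e -> exists n, (P ((\bigcup_i K i) `\` K n) < e%:E)%E.
Proof.
move=> mK hK e0; pose V := \bigcup_i K i.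
have mV : measurable V by exact: bigcupT_measurable.
have mD n : measurable (V `\` K n) by exact: measurableD.
have := @nonincreasing_cvg_mu _ _ _ P (fun n => V `\` K n).
have -> : \bigcap_n (V `\` K n) = set0.
  by apply/seteqP; split=> // x h; have [[i _ Kx] _] := h 0%N I; have [_] := h i I.
rewrite measure0 => /(_ _ _ _ _ [set x | (x < e%:E)%E]) h.
have [] := h _ _ _ _.
- by rewrite (le_lt_trans (probability_le1 _ _))// ltry.
- exact: mD.
- exact: measurable0.
- by move=> i j ij; apply/subsetPset; apply: setDS; exact: hK.
- by apply: open_nbhs_nbhs; split; [exact: open_ereal_lt_ereal|rewrite /= lte_fin].
- by move=> n _ /(_ n) /= hn; exists n; apply: hn => /=.
Qed.

Variables (A : finType) (X : shiftSpace A) (P : probability (borel X) R).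

Definition regular_set (G : set (borel X)) : Prop :=
  forall e : R, 0 < e -> exists F V : set X,
    [/\ closed F, open V, F `<=` G, G `<=` V &
        (P (V `\` F : set (borel X)) < e%:E)%E].

Lemma measurable_closed (F : set (borel X)) : closed (F : set X) -> measurable F.
Proof.
by move=> /closed_openC/measurable_open/measurableC; rewrite setCK.
Qed.

Lemma regular_open (U : set X) : open U -> regular_set U.
Proof.
move=> oU e e0.
have [n nU] := @bigcup_approx _ (borel X) P (fun n => inner n U) e
  (fun n => measurable_window (@window_inner _ _ n U))
  (fun n m nm => @innerW _ _ _ _ _ nm) e0.
exists (inner n U), U; split=> //.
- by apply: (@closed_window _ _ n); exact: window_inner.
- exact: inner_sub.
- by rewrite -[X in X `\` _](bigcup_inner oU).
Qed.

(** Complementation exchanges the closed and the open approximation. For a countable union, half of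
    [e] is spread over the individual approximations; the other half pays for cutting the union of
    the closed sets at a finite stage, which keeps it closed. *)
Lemma regular_sigma_algebra : sigma_algebra setT regular_set.
Proof.
split.
- by apply: regular_open; exact: open0.
- move=> G rG e /rG[F [V [cF oV FG GV h]]]; exists (~` V), (~` F); split=> //.
  + exact: open_closedC.
  + exact: closed_openC.
  + by move=> x nVx; split=> // /GV.
  + by move=> x [_ nGx] /FG.
  + by rewrite setDE setCK setIC -setDE.
- move=> G rG e e0.
  have e2 n : 0 < (e / 2) / (2 ^ n.+1)%:R by rewrite divr_gt0 ?divr_gt0// ltr0n expn_gt0.
  have /choice[F /choice[V FV]] n := rG n _ (e2 n).
  have cF n : closed (F n) by have [] := FV n.
  have oV n : open (V n) by have [] := FV n.
  have FG n : F n `<=` G n by have [] := FV n.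
  have GV n : G n `<=` V n by have [] := FV n.
  have PFV n : (P (V n `\` F n : set (borel X)) <= ((e / 2) / (2 ^ n.+1)%:R)%:E)%E.
    by have [_ _ _ _ /ltW] := FV n.
  pose K n : set X := \big[setU/set0]_(i < n) F i.
  have cK n : closed (K n).
    by apply: (big_ind closed) => //; [exact: closed0|move=> *; exact: closedU].
  have mF n : measurable (F n : set (borel X)) by exact: measurable_closed.
  have mV n : measurable (V n : set (borel X)) by exact: measurable_open.
  have [||n Kn] := @bigcup_approx _ (borel X) P K (e / 2)
    (fun n => measurable_closed (cK n)).
  - by move=> n m nm; apply/subset_bigsetU.
  - by rewrite divr_gt0.
  have KF : \bigcup_n K n = \bigcup_n F n.
    apply/seteqP; split=> x [i _].
      by rewrite /K -bigcup_mkord => -[j _ Fx]; exists j.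
    by move=> Fx; exists i.+1 => //; rewrite /K -bigcup_mkord; exists i => /=.
  rewrite KF in Kn.
  exists (K n), (\bigcup_n V n); split=> //.
  + exact: bigcup_open.
  + rewrite /K -bigcup_mkord => x [i _ /FG Gx]; by exists i.
  + by move=> x [i _ /GV Vx]; exists i.
  have mUF : measurable (\bigcup_n F n : set (borel X)) by exact: bigcupT_measurable.
  have mUV : measurable (\bigcup_n V n : set (borel X)) by exact: bigcupT_measurable.
  have mK : measurable (K n : set (borel X)) by exact: measurable_closed.
  have h1 : (P (\bigcup_n V n `\` \bigcup_n F n : set (borel X)) <= (e / 2)%:E)%E.
    apply: le_trans (epsilon_trick0 xpredT _); last by rewrite divr_ge0// ltW.
    have := @measure_sigma_subadditive _ R (borel X) P
       (\bigcup_n V n `\` \bigcup_n F n) (fun n => V n `\` F n) => h.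
    apply: (le_trans (h _ _ _)).
    * by move=> i; exact: measurableD.
    * exact: measurableD.
    * move=> x [[i _ Vx] nFx]; exists i => //; split=> // Fx; apply: nFx; by exists i.
    * by apply: lee_nneseries => [i _ _|i _] //; exact: PFV.
  have -> : e%:E = ((e / 2)%:E + (e / 2)%:E)%E by rewrite -EFinD -splitr.
  apply: le_lt_trans (lee_ltD _ h1 Kn); last first.
    by rewrite fin_num_measure//; exact: measurableD.
  apply: le_trans (measureU2 _ _ _); [|exact: measurableD|exact: measurableD].
  apply: le_measure; rewrite ?inE; [exact: measurableD| |].
    by apply: measurableU; exact: measurableD.
  move=> x [Vx nKx]; have [Fx|nFx] := pselect ((\bigcup_n F n) x).
    by right; split.
  by left; split.
Qed.

Lemma regular_measurable (G : set (borel X)) : measurable G -> regular_set G.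
Proof.
apply: (@smallest_sub _ (sigma_algebra setT) (open : set (set (points X)))).
  exact: regular_sigma_algebra.
exact: regular_open.
Qed.

(** Regularity gives an open superset of nearly the same measure, which is then exhausted from
    inside by window sets. *)
Lemma window_approx (G : set (borel X)) (e : R) : measurable G -> 0 < e ->
  exists n S, window_set n (S : set X) /\
    (P (G `\` S) + P (S `\` G) < e%:E)%E.
Proof.
move=> mG e0; have e20 : 0 < e / 2 by rewrite divr_gt0.
have [F [V [cF oV FG GV hFV]]] := regular_measurable mG e20.
have [n nV] := @bigcup_approx _ (borel X) P (fun n => inner n V) (e / 2)
  (fun n => measurable_window (@window_inner _ _ n V))
  (fun n m nm => @innerW _ _ _ _ _ nm) e20.
have mF : measurable (F : set (borel X)) by exact: measurable_closed.
have mV : measurable (V : set (borel X)) by exact: measurable_open.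
have mS : measurable (inner n V : set (borel X)).
  exact: measurable_window (@window_inner _ _ n V).
rewrite (bigcup_inner oV) in nV.
exists n, (inner n V); split; first exact: window_inner.
have -> : e%:E = ((e / 2)%:E + (e / 2)%:E)%E by rewrite -EFinD -splitr.
apply: lteD.
  apply: le_lt_trans nV; apply: le_measure; rewrite ?inE; try exact: measurableD.
  exact: setSD.
apply: le_lt_trans hFV; apply: le_measure; rewrite ?inE; try exact: measurableD.
by move=> x [/inner_sub Vx nG]; split=> // /FG.
Qed.

End Regularity.

Section Shift.
Variables (A : finType) (X : shiftSpace A).
Implicit Types x y : X.

Lemma seq_shift n x m : seq_of (shift_map n x) m = seq_of x (m + n).
Proof. by []. Qed.

Lemma eq_point x y : (forall m, seq_of x m = seq_of y m) -> x = y.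
Proof. by move=> h; apply: seq_of_inj; apply/funext. Qed.

Lemma shift_mapD m n x : shift_map m (shift_map n x) = shift_map (m + n) x.
Proof. by apply: eq_point => i; rewrite !seq_shift addrA. Qed.

Lemma shift_map0 x : shift_map 0 x = x.
Proof. by apply: eq_point => i; rewrite seq_shift addr0. Qed.

End Shift.

(** * Factor codes as sliding block codes *)

Section Code.
Variables (A B : finType) (X : shiftSpace A) (Y : shiftSpace B).
Variable (pi : factorCode X Y).

Lemma factor_shift n x : pi (shift_map n x) = shift_map n (pi x).
Proof.
have pos (k : nat) z : pi (shift_map k%:Z z) = shift_map k%:Z (pi z).
  elim: k => [|k IHk]; first by rewrite !shift_map0.
  rewrite intS -shift_mapD (@factor_equivariant _ _ _ _ pi) IHk.
  by rewrite shift_mapD.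
case: n => [k|k]; first exact: pos.
have -> : pi x = shift_map k.+1%:Z (pi (shift_map (Negz k) x)).
  by rewrite -pos shift_mapD NegzE addrN shift_map0.
by rewrite shift_mapD NegzE addNr shift_map0.
Qed.

Lemma shift_set_compact : compact (shift_set X).
Proof.
apply: (@subclosed_compact _ _ setT) => //; first exact: shift_closed.
rewrite (_ : setT = [set f : fullShift A | forall i, setT (f i)]).
  apply: (@tychonoff int (fun=> discrete_topology A) (fun=> setT)) => i.
  by apply: finite_compact; exact: (@finite_finset A).
by apply/seteqP.
Qed.

(** The Curtis-Hedlund-Lyndon argument: by continuity a window around [x] determines the symbol of
    [pi x] at 0, and compactness gives one window size for all points. *)
Lemma block_code0 : exists r, forall x x' : X, agree r (seq_of x) (seq_of x') ->
  seq_of (pi x) 0 = seq_of (pi x') 0.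
Proof.
pose Q r (u : fullShift A) := forall x x' : X, seq_of x = u ->
  agree r u (seq_of x') -> seq_of (pi x) 0 = seq_of (pi x') 0.
have /compact_near_coveringP cX := shift_set_compact.
have [|r _ hr] := cX nat \oo Q _; last first.
  exists r => x x' xx'; apply: (hr r _ _ _ x x') => //=; exact: mem_seq_of.
move=> u /point_of[x <-].
have /open_sub_cyl : open (pi @^-1` [set y | seq_of y 0 = seq_of (pi x) 0]).
  apply: open_comp => [z _|]; first exact: factor_continuous.
  by apply: (@open_window _ _ 0) => y z yz /= <-; rewrite yz.
move=> /(_ x erefl)[n hn].
exists ([set v | agree n (seq_of x) v], [set r | (n <= r)%N]).
  split; last by exists n.
  by apply: (@open_nbhs_nbhs (fullShift A)); split; [exact: agree_open|].
move=> [v r] /= [xv nr] z z' zv vz'.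
have -> : seq_of (pi z) 0 = seq_of (pi x) 0 by apply: hn; rewrite /cyl /= zv.
apply/esym/hn; apply: agree_trans xv _; exact: agreeW vz'.
Qed.

Lemma block_code : exists r : nat, forall (x x' : X) (m : int),
  (forall i, (`|i - m| <= r)%N -> seq_of x i = seq_of x' i) ->
  seq_of (pi x) m = seq_of (pi x') m.
Proof.
have [r hr] := block_code0; exists r => x x' m xx'.
rewrite -[m]add0r -!seq_shift -!factor_shift; apply: hr => i ir.
by rewrite !seq_shift xx'// addrK.
Qed.

End Code.

(** * The cocycle of a potential *)

(** The inequality [|i| < d] is strict, so that [w 0] bounds the total oscillation of [f] and [w d]
    goes with agreement on [2 d - 1] places. *)
Definition modulus (R : realType) (B : finType) (Y : shiftSpace B) (f : Y -> R)
    (w : nat -> R) (W : R) : Prop :=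
  [/\ forall d, 0 <= w d,
      forall d (x y : Y),
        (forall i, (`|i| < d)%N -> seq_of x i = seq_of y i) ->
        `|f x - f y| <= w d &
      forall n, \sum_(0 <= d < n) w d <= W].

Section Modulus.
Variables (R : realType) (B : finType) (Y : shiftSpace B) (f : Y -> R).

Lemma potential_var_ge0 d : (0 <= potential_var f d)%E.
Proof.
case: d => [|d] /=.
  by apply: (@le_trans _ _ `|f point|%:E); [rewrite lee_fin|apply: ereal_sup_ubound; exists point].
apply: ereal_sup_ubound; exists point, point; split=> //.
by rewrite subrr normr0.
Qed.

Lemma modulus_exists : summable_variation f -> exists w W, modulus f w W.
Proof.
move=> [_ sv]; set pv := potential_var f.
have pv0 d : (0 <= pv d)%E by exact: potential_var_ge0.
have sum_le n : (\sum_(0 <= d < n) pv d <= \sum_(0 <= d <oo) pv d)%E.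
  exact: nneseries_lim_ge.
have S_fin : (\sum_(0 <= d <oo) pv d)%E \is a fin_num.
  by rewrite ge0_fin_numE//; apply: nneseries_ge0.
have pv_fin d : pv d \is a fin_num.
  rewrite ge0_fin_numE//; apply: le_lt_trans sv; apply: le_trans (sum_le d.+1).
  by rewrite big_nat_recr//= leeDr// sume_ge0.
(* The factor 2 is needed at [d = 0], where the sup norm controls only half of the oscillation. *)
pose w d := 2 * fine (pv d).
exists w, (2 * fine (\sum_(0 <= d <oo) pv d)%E); split.
- by move=> d; rewrite mulr_ge0// fine_ge0.
- move=> d x y xy; case: d xy => [|d] xy.
    rewrite (le_trans (ler_normB _ _))// /w mulr2n mulrDl mul1r.
    by apply: lerD; rewrite -lee_fin fineK//;
      apply: ereal_sup_ubound; [exists x|exists y].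
  apply: (@le_trans _ _ (fine (pv d.+1))).
    rewrite -lee_fin fineK//; apply: ereal_sup_ubound; exists x, y; split=> //.
  by rewrite /w mulr2n mulrDl mul1r lerDl fine_ge0.
- move=> n; rewrite -mulr_sumr ler_pM2l// -lee_fin fineK//.
  apply: le_trans (sum_le n); rewrite -sumEFin; apply: lee_sum => i _.
  by rewrite fineK.
Qed.

End Modulus.

(** * Estimates for finite sums governed by the modulus *)

Section Sums.
Variables (R : realType) (w : nat -> R) (W : R).
Hypothesis w0 : forall d, 0 <= w d.
Hypothesis wW : forall n, \sum_(0 <= d < n) w d <= W.

(** Subtraction is truncated: the first [K] terms equal [w 0], and the later ones run through [w]
    from its start. *)
Lemma sum_modulus_sub n K : \sum_(0 <= k < n) w (k - K) <= w 0%N *+ K + W.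
Proof.
have W0 : 0 <= W by have := wW 0; rewrite big_geq.
have [nK|Kn] := leqP n K.
  rewrite (eq_big_nat _ _ (F2 := fun=> w 0%N)); last first.
    by move=> k /andP[_ kn]; rewrite (_ : (k - K)%N = 0%N) //; lia.
  rewrite sumr_const_nat subn0.
  rewrite (@le_trans _ _ (w 0%N *+ K)) ?lerDl//.
  by rewrite -!(mulr_natr (w 0%N)) ler_wpM2l// ler_nat.
rewrite (@big_cat_nat _ _ _ K)//=; last exact: ltnW.
apply: lerD.
  rewrite (eq_big_nat _ _ (F2 := fun=> w 0%N)); last first.
    by move=> k /andP[_ kn]; rewrite (_ : (k - K)%N = 0%N) //; lia.
  by rewrite sumr_const_nat subn0.
rewrite -{1}[K]add0n big_addn (eq_bigr w) ?wW// => k _.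
by rewrite addnK.
Qed.

Lemma sum_modulus_rev n K : \sum_(0 <= k < n) w (n - k - K) <= w 0%N *+ K + W.
Proof.
apply: le_trans (sum_modulus_sub n.+1 K).
rewrite big_nat_rev /= [leRHS]big_nat_recl//= -[leLHS]add0r; apply: lerD => //.
rewrite le_eqVlt; apply/orP; left; apply/eqP.
rewrite big_nat [RHS]big_nat; apply: eq_bigr => k /andP[_ kn].
by congr (w (_ - _)%N); lia.
Qed.

(** Raising the displacement by one changes the sum by a telescoping difference of two values, which
    costs at most [w 0]. A negative displacement becomes a positive one after translating [g]. *)
Lemma telescope_shift (g : int -> R) (n : nat) (j : int) :
  (forall a b, `|g a - g b| <= w 0%N) ->
  `|\sum_(0 <= k < n) (g (k%:Z + j) - g k%:Z)| <= w 0%N *+ `|j|%N.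
Proof.
have pos (h : int -> R) (i : nat) : (forall a b, `|h a - h b| <= w 0%N) ->
    `|\sum_(0 <= k < n) (h (k%:Z + i%:Z) - h k%:Z)| <= w 0%N *+ i.
  move=> hw; elim: i => [|i IHi].
    rewrite mulr0n big1 ?normr0// => k _; by rewrite addr0 subrr.
  have -> : \sum_(0 <= k < n) (h (k%:Z + i.+1%:Z) - h k%:Z) =
     \sum_(0 <= k < n) (h (k%:Z + i%:Z) - h k%:Z) + (h (n%:Z + i%:Z) - h i%:Z).
    clear IHi; elim: n => [|m IHm].
      by rewrite !big_geq// !add0r subrr.
    rewrite !big_nat_recr//= IHm (_ : m%:Z + i.+1%:Z = m.+1%:Z + i%:Z); last by lia.
    by ring.
  by rewrite mulrSr (le_trans (ler_normD _ _))// lerD.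
move=> gw; case: j => i; first exact: pos.
have := pos (fun a => g (a + Negz i)) i.+1.
rewrite [`|Negz i|%N](_ : _ = i.+1)// => h.
rewrite -normrN -sumrN (eq_bigr (fun k => g (k%:Z + i.+1%:Z + Negz i) - g (k%:Z + Negz i))).
  by apply: h => a b; exact: gw.
by move=> k _; rewrite opprB NegzE addrK.
Qed.

(** In the application [a], [b], [c], [d] are the values of the potential along [x'], [x], [y'],
    [y], and [d'] those along a translate of [y]. Below [n] the terms are paired as [a - c] and
    [b - d'], from [n] on as [a - b] and [c - d]; [J] pays for the translation. *)
Lemma sum_compare (a b c d d' : nat -> R) (n K Q : nat) (J : R) :
  (forall k, (k < n)%N -> `|a k - c k| <= w (n - k - K)) ->
  (forall k, (k < n)%N -> `|b k - d' k| <= w (n - k - K)) ->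
  (forall k, (n <= k)%N -> `|a k - b k| <= w (k - n - K)) ->
  (forall k, (n <= k)%N -> `|c k - d k| <= w (k - n - K)) ->
  `|\sum_(0 <= k < n) (d' k - d k)| <= J ->
  `|\sum_(0 <= k < Q + n) (a k - b k - (c k - d k))| <=
    (w 0%N *+ K + W) *+ 4 + J.
Proof.
move=> hac hbd hab hcd hJ; set S := w 0%N *+ K + W.
rewrite (@big_cat_nat _ _ _ n)//= ?leq_addl//.
have -> : \sum_(0 <= k < n) (a k - b k - (c k - d k)) =
   \sum_(0 <= k < n) (a k - c k) - \sum_(0 <= k < n) (b k - d' k)
     - \sum_(0 <= k < n) (d' k - d k).
  by rewrite -!sumrB; apply: eq_bigr => k _; ring.
have le_sum (u : nat -> R) : (forall k, (k < n)%N -> `|u k| <= w (n - k - K)) ->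
    `|\sum_(0 <= k < n) u k| <= S.
  move=> hu; apply: le_trans (sum_modulus_rev n K).
  apply: le_trans (ler_norm_sum _ _ _) _; rewrite big_nat [leRHS]big_nat.
  by apply: ler_sum => k /andP[_ kn]; exact: hu.
have le_tail (u : nat -> R) : (forall k, (n <= k)%N -> `|u k| <= w (k - n - K)) ->
    `|\sum_(n <= k < Q + n) u k| <= S.
  move=> hu; rewrite -{1}[n]add0n big_addn addnK.
  apply: le_trans (sum_modulus_sub Q K).
  apply: le_trans (ler_norm_sum _ _ _) _; apply: ler_sum => k _.
  by rewrite (le_trans (hu _ _))// ?leq_addl// addnK.
have -> : \sum_(n <= k < Q + n) (a k - b k - (c k - d k)) =
    \sum_(n <= k < Q + n) (a k - b k) - \sum_(n <= k < Q + n) (c k - d k).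
  by rewrite -sumrB.
have := le_sum _ hac; have := le_sum _ hbd.
have := le_tail _ hab; have := le_tail _ hcd; move: hJ.
rewrite (_ : S *+ 4 = S + S + S + S); last by rewrite !mulrS addr0 !addrA.
clearbody S; rewrite !ler_norml.
move: (\sum_(0 <= k < n) (a k - c k)) (\sum_(0 <= k < n) (b k - d' k)).
move: (\sum_(0 <= k < n) (d' k - d k)).
move: (\sum_(n <= k < Q + n) (a k - b k)) (\sum_(n <= k < Q + n) (c k - d k)).
move=> s1 s2 s3 s4 s5 /andP[? ?] /andP[? ?] /andP[? ?] /andP[? ?] /andP[? ?].
apply/andP; split; lra.
Qed.

End Sums.

Lemma lim_norm_le (R : realType) (u : R^nat) (C : R) (n : nat) :
  cvgn u -> (forall Q, `|u (Q + n)%N| <= C) -> `|limn u| <= C.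
Proof.
move=> cu h; rewrite ler_norml; apply/andP; split.
  apply: limr_ge => //; exists n => // k /= nk.
  by have := h (k - n)%N; rewrite subnK// ler_norml => /andP[].
apply: limr_le => //; exists n => // k /= nk.
by have := h (k - n)%N; rewrite subnK// ler_norml => /andP[].
Qed.

Lemma lim_seriesS (R : realType) (u : R^nat) : cvgn (series u) ->
  limn (series u) = u 0%N + limn (series (fun k => u k.+1)).
Proof.
move=> cu; pose v : R^nat := fun k => u k.+1.
have cS : (fun n => series u n.+1) @ \oo --> limn (series u).
  by rewrite (@cvg_shiftS R^o).
have E : series v = (fun n => series u n.+1) \- cst (u 0%N).
  apply/funext => n; rewrite /series /= big_nat_recl//=.
  by rewrite addrAC subrr add0r.
have : series v @ \oo --> limn (series u) - u 0%N.
  by rewrite E; apply: cvgB => //; exact: cvg_cst.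
by move=> /cvg_lim -> //; rewrite addrC subrK.
Qed.

Section Cocycle.
Variables (R : realType) (B : finType) (Y : shiftSpace B) (f : Y -> R).
Variables (w : nat -> R) (W : R).
Hypothesis fw : modulus f w W.
Implicit Types x y z p : Y.

Definition agree_off (N : nat) (x y : Y) : Prop :=
  forall m, (N < `|m|)%N -> seq_of x m = seq_of y m.

Lemma gibbs_relP x y : gibbs_rel x y <-> exists N, agree_off N x y.
Proof.
split=> [[N _ h]|[N h]]; first by exists N.
by exists N.+1 => // m mN; apply: h; exact: ltnW.
Qed.

Let w0 : forall d, 0 <= w d. Proof. by case: fw. Qed.
Let wosc : forall d x y,
  (forall i, (`|i| < d)%N -> seq_of x i = seq_of y i) -> `|f x - f y| <= w d.
Proof. by case: fw. Qed.
Let wW : forall n, \sum_(0 <= d < n) w d <= W. Proof. by case: fw. Qed.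

Lemma cvg_modulus_series (N : nat) (u : R^nat) :
  (forall k, `|u k| <= w (k - N)) -> cvgn (series u).
Proof.
move=> uw; apply: normed_cvg.
apply: (@series_le_cvg _ _ (fun k => w (k - N))) => //; first by move=> k; exact: normr_ge0.
apply: nondecreasing_is_cvgn.
  by apply/nondecreasing_seqP => n; rewrite /series /= big_nat_recr//= lerDl.
exists (w 0%N *+ N + W) => _ [n _ <-].
exact: sum_modulus_sub.
Qed.

Let fpos x y (k : nat) := f (shift_map k%:Z y) - f (shift_map k%:Z x).
Let fneg x y (k : nat) := f (shift_map (- k.+1%:Z) y) - f (shift_map (- k.+1%:Z) x).

Lemma cvg_fpos x y : gibbs_rel x y -> cvgn (series (fpos x y)).
Proof.
move=> /gibbs_relP[N xy]; apply: (@cvg_modulus_series N) => k.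
apply: wosc => i ik; rewrite !seq_shift xy//; lia.
Qed.

Lemma cvg_fneg x y : gibbs_rel x y -> cvgn (series (fneg x y)).
Proof.
move=> /gibbs_relP[N xy]; apply: (@cvg_modulus_series N) => k.
apply: wosc => i ik; rewrite !seq_shift xy//; lia.
Qed.

Lemma gibbs_rel_refl x : gibbs_rel x x.
Proof. by exists 1%N. Qed.

Lemma gibbs_rel_sym x y : gibbs_rel x y -> gibbs_rel y x.
Proof. by move=> [N N1 h]; exists N => // m /h. Qed.

Lemma gibbs_rel_trans x y z : gibbs_rel x y -> gibbs_rel y z -> gibbs_rel x z.
Proof.
move=> [N N1 h] [M M1 k]; exists (maxn N M); first by rewrite leq_max N1.
by move=> m; rewrite gtn_max => /andP[? ?]; rewrite h// k.
Qed.

Lemma gibbs_rel_shift n x y : gibbs_rel x y -> gibbs_rel (shift_map n x) (shift_map n y).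
Proof.
move=> [N N1 h]; exists (N + `|n|)%N; first by rewrite addn_gt0 N1.
by move=> m mN; rewrite !seq_shift h//; lia.
Qed.

Lemma cocycle_trans x y z : gibbs_rel x y -> gibbs_rel y z ->
  potential_cocycle f x z = potential_cocycle f x y + potential_cocycle f y z.
Proof.
move=> xy yz; rewrite /potential_cocycle /sumZ addrACA; congr (_ + _).
  rewrite -limD; [|exact: cvg_fpos|exact: cvg_fpos].
  congr (limn _); apply/funext => n; rewrite !fctE /series /= -big_split/=.
  by apply: eq_bigr => k _; rewrite addrC addrA subrK.
rewrite -limD; [|exact: cvg_fneg|exact: cvg_fneg].
congr (limn _); apply/funext => n; rewrite !fctE /series /= -big_split/=.
by apply: eq_bigr => k _; rewrite addrC addrA subrK.
Qed.

Lemma cocycle_refl x : potential_cocycle f x x = 0.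
Proof.
have := cocycle_trans (gibbs_rel_refl x) (gibbs_rel_refl x); lra.
Qed.

Lemma cocycle_sym x y : gibbs_rel x y ->
  potential_cocycle f y x = - potential_cocycle f x y.
Proof.
move=> xy; have := cocycle_trans xy (gibbs_rel_sym xy).
by rewrite cocycle_refl; lra.
Qed.

(** The shift moves one term from the nonnegative half of the two-sided series to the negative
    half. *)
Lemma cocycle_shift x y : gibbs_rel x y ->
  potential_cocycle f (shift_map 1 x) (shift_map 1 y) = potential_cocycle f x y.
Proof.
move=> xy; have sxy := gibbs_rel_shift 1 xy.
rewrite /potential_cocycle /sumZ.
rewrite -/(fpos (shift_map 1 x) (shift_map 1 y)) -/(fneg (shift_map 1 x) (shift_map 1 y)).
rewrite -/(fpos x y) -/(fneg x y).
have cp := cvg_fpos xy; have cn := cvg_fneg xy.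
have fpS k : fpos x y k.+1 = fpos (shift_map 1 x) (shift_map 1 y) k.
  by rewrite /fpos !shift_mapD (_ : k%:Z + 1 = k.+1%:Z)//; lia.
have fn0 : fneg (shift_map 1 x) (shift_map 1 y) 0%N = fpos x y 0%N.
  by rewrite /fneg /fpos !shift_mapD addNr.
have fnS k : fneg (shift_map 1 x) (shift_map 1 y) k.+1 = fneg x y k.
  by rewrite /fneg !shift_mapD (_ : - k.+2%:Z + 1 = - k.+1%:Z)//; lia.
rewrite (lim_seriesS (cvg_fpos xy)) (lim_seriesS (cvg_fneg sxy)) fn0.
rewrite (eq_fun fpS) (eq_fun fnS); ring.
Qed.

(** Inside the window [x'] is compared with [y'] and [x] with the translate of [y] by [j]; outside,
    [x] with [x'] and [y] with [y']. Both half-lines give the same bound, and it is independent of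
    [n]: this is where summable variation makes the later constants uniform. *)
Lemma cocycle_compare K n j x x' y y' : (`|j| <= K)%N ->
  agree_off (n + K) x x' -> agree_off n y y' -> agree n (seq_of x') (seq_of y') ->
  (forall m, (`|(m + j)%R| <= n)%N -> seq_of x m = seq_of y (m + j)) ->
  `|potential_cocycle f x x' - potential_cocycle f y y'| <=
    ((w 0%N *+ K + W) *+ 4 + w 0%N *+ K) *+ 2.
Proof.
move=> jK xx' yy' x'y' xy.
have gx : gibbs_rel x x' by apply/gibbs_relP; exists (n + K)%N.
have gy : gibbs_rel y y' by apply/gibbs_relP; exists n.
have w0K : w 0%N *+ `|j|%N <= w 0%N *+ K.
  by rewrite -!(mulr_natr (w 0%N)) ler_wpM2l// ler_nat.
have w_any a b : `|f a - f b| <= w 0%N by apply: wosc => i; rewrite ltn0.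
have sub (u v : R^nat) (C : R) : cvgn (series u) -> cvgn (series v) ->
    (forall Q, `|\sum_(0 <= k < Q + n) (u k - v k)| <= C) ->
    `|limn (series u) - limn (series v)| <= C.
  move=> cu cv h; rewrite -limB//; apply: (@lim_norm_le _ _ _ n).
    exact: is_cvgB.
  by move=> Q; rewrite /series /= fctE -sumrB; exact: h.
rewrite mulr2n /potential_cocycle /sumZ opprD addrACA.
apply: le_trans (ler_normD _ _) _; apply: lerD.
  apply: sub; [exact: cvg_fpos|exact: cvg_fpos|] => Q.
  apply: (@sum_compare _ _ _ w0 wW _ _ _ _ (fun k => f (shift_map (k%:Z + j) y))).
  - move=> k kn; apply: wosc => i ik; rewrite !seq_shift x'y'//; lia.
  - move=> k kn; apply: wosc => i ik; rewrite !seq_shift xy; last lia.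
    by congr (seq_of y _); lia.
  - move=> k kn; apply: wosc => i ik; rewrite !seq_shift xx'//; lia.
  - move=> k kn; apply: wosc => i ik; rewrite !seq_shift yy'//; lia.
  - apply: le_trans w0K.
    exact: (@telescope_shift _ _ (fun a => f (shift_map a y))).
apply: sub; [exact: cvg_fneg|exact: cvg_fneg|] => Q.
apply: (@sum_compare _ _ _ w0 wW _ _ _ _ (fun k => f (shift_map (- k.+1%:Z + j) y))).
- move=> k kn; apply: wosc => i ik; rewrite !seq_shift x'y'//; lia.
- move=> k kn; apply: wosc => i ik; rewrite !seq_shift xy; last lia.
  by congr (seq_of y _); lia.
- move=> k kn; apply: wosc => i ik; rewrite !seq_shift xx'//; lia.
- move=> k kn; apply: wosc => i ik; rewrite !seq_shift yy'//; lia.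
- apply: le_trans w0K; rewrite -abszN.
  have := @telescope_shift _ w (fun a => f (shift_map (- (a + 1)) y)) n (- j).
  move=> /(_ (fun a b => w_any _ _)).
  rewrite (eq_bigr (fun k : nat => f (shift_map (- k.+1%:Z + j) y) -
      f (shift_map (- k.+1%:Z) y)))// => k _.
  by congr (f (shift_map _ y) - f (shift_map _ y)); lia.
Qed.

End Cocycle.

(** * Shifts of finite type and finite-to-one codes *)

(** Finite type in local form: membership is tested on blocks of length [M], each of which may come
    from a different point. *)
Definition memory (A : finType) (X : shiftSpace A) (M : nat) : Prop :=
  forall u : fullShift A,
    (forall i : int, exists x : X,
       forall m : int, i <= m < i + M%:Z -> u m = seq_of x m) ->
    shift_set X u.

Section Memory.
Variables (A : finType) (X : shiftSpace A).
Implicit Types x y z : X.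

Lemma memoryW M M' : (M <= M')%N -> memory X M -> memory X M'.
Proof.
move=> MM' hM u h; apply: hM => i; have [x hx] := h i.
by exists x => m mi; apply: hx; lia.
Qed.

Lemma finite_type_memory : finite_type X -> exists M, memory X M.
Proof.
move=> [F FX]; exists (\max_(w <- F) size w)%N => u hu; rewrite FX /= => w wF [i wE].
have [x hx] := hu i.
have := mem_seq_of x; rewrite FX => /(_ w wF); apply; exists i.
rewrite {1}wE; apply: (@eq_from_nth _ (seq_of x 0)); rewrite !size_mkseq// => k kw.
rewrite !nth_mkseq// hx//.
have : (size w <= \max_(w <- F) size w)%N by apply: leq_bigmax_seq.
lia.
Qed.

Variable (M : nat).
Hypothesis M0 : (0 < M)%N.
Hypothesis hM : memory X M.

(** The blocks of length [M] serve as the vertices of a finite graph presenting [X]; [conn] below is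
    the existence of a path with [l] edges. *)
Definition state (x : X) (i : int) : {ffun 'I_M -> A} :=
  [ffun k : 'I_M => (seq_of x (i + k%:Z) : A)].

Lemma stateP x y i j : state x i = state y j <->
  forall k : nat, (k < M)%N -> seq_of x (i + k%:Z) = seq_of y (j + k%:Z).
Proof.
split=> [/ffunP h k kM|h]; first by have := h (Ordinal kM); rewrite !ffunE.
by apply/ffunP => k; rewrite !ffunE h.
Qed.

Lemma state_shift n x i : state (shift_map n x) i = state x (i + n).
Proof. by apply/stateP => k kM; rewrite seq_shift; congr (seq_of _ _); lia. Qed.

(** The overlap has length [M], so every block of length [M] of the glued sequence lies entirely in
    the part from [x] or in the part from [y]. *)
Lemma glue x y i j : state x i = state y j -> exists z,
  (forall m, m < i + M%:Z -> seq_of z m = seq_of x m) /\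
  (forall m, i <= m -> seq_of z m = seq_of y (m - i + j)).
Proof.
move=> /stateP xy.
pose u : fullShift A := fun m => if m < i then seq_of x m else seq_of y (m - i + j).
have ux m : m < i + M%:Z -> u m = seq_of x m.
  move=> mi; rewrite /u; case: ltP => // im.
  have := xy (absz (m - i)); rewrite (_ : i + _ = m); last by lia.
  by move=> ->; [congr (seq_of y _); lia|lia].
have uy m : i <= m -> u m = seq_of y (m - i + j) by rewrite /u ltNge => ->.
have [z zu] : exists z, seq_of z = u.
  apply: point_of; apply: hM => l; have [li|il] := ltP l i.
    by exists x => m ml; apply: ux; lia.
  exists (shift_map (j - i) y) => m ml; rewrite seq_shift uy; last by lia.
  by congr (seq_of y _); lia.
by exists z; rewrite zu.
Qed.

Definition conn (a b : {ffun 'I_M -> A}) (l : nat) : Prop :=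
  exists x, state x 0 = a /\ state x l%:Z = b.

Lemma conn_state x i l : conn (state x i) (state x (i + l%:Z)) l.
Proof. by exists (shift_map i x); rewrite !state_shift add0r addrC. Qed.

Lemma conn_cat a b c l k : conn a b l -> conn b c k -> conn a c (l + k).
Proof.
move=> [x [xa xb]] [y [yb yc]].
have [|z [zx zy]] := @glue x y l%:Z 0; first by rewrite xb.
exists z; split; [rewrite -xa|rewrite -yc]; apply/stateP => i iM.
  by rewrite zx//; lia.
by rewrite zy; [congr (seq_of y _); lia|lia].
Qed.

(** The two collars have width [M], so a block of length [M] either stays where the new sequence is
    [x] or stays where it coincides with [y]. *)
Lemma patch_point n x y :
  (forall m, (n < `|m| <= n + M)%N -> seq_of x m = seq_of y m) ->
  exists z, (forall m, (`|m| <= n + M)%N -> seq_of z m = seq_of x m) /\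
    agree_off n y z.
Proof.
move=> xy; pose u : fullShift A :=
  fun m => if (`|m| <= n + M)%N then seq_of x m else seq_of y m.
have uy m : (n < `|m|)%N -> u m = seq_of y m.
  by move=> nm; rewrite /u; case: leqP => // mn; rewrite xy// nm.
have [z zu] : exists z, seq_of z = u.
  apply: point_of; apply: hM => i.
  have [h|h] := boolP ((- (n + M)%N%:Z <= i) && (i + M%:Z <= (n + M)%N%:Z + 1)).
    by exists x => m mi; rewrite /u ifT//; lia.
  by exists y => m mi; apply: uy; lia.
exists z; rewrite zu; split; first by move=> m mn; rewrite /u mn.
by move=> m /uy <-; rewrite zu.
Qed.

Hypothesis irr : irreducible X.

Lemma conn_irreducible x y i j : exists2 l, (M <= l)%N & conn (state x i) (state y j) l.
Proof.
pose word z k := mkseq (fun t : nat => seq_of z (k + t%:Z) : A) M.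
have lw z k : language X (word z k).
  by exists z, k; rewrite size_mkseq.
have [w _ [z [s /= sE]]] := irr (lw x i) (lw y j).
have szE : size (word x i ++ w ++ word y j) = (M + (size w + M))%N.
  by rewrite !size_cat !size_mkseq.
have nthE t : (t < M + (size w + M))%N ->
    nth (seq_of z 0) (word x i ++ w ++ word y j) t = seq_of z (s + t%:Z).
  by move=> tM; rewrite sE nth_mkseq// szE.
exists (M + size w)%N; first by rewrite leq_addr.
exists (shift_map s z); split; rewrite state_shift; apply/stateP => t tM.
  rewrite add0r -nthE; last by lia.
  by rewrite nth_cat size_mkseq tM nth_mkseq.
rewrite (_ : _ + _ + _ = s + (M + (size w + t))%N%:Z); last by lia.
rewrite -nthE; last by lia.
rewrite nth_cat size_mkseq ltnNge leq_addr/= addKn.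
by rewrite nth_cat ltnNge leq_addr/= addKn nth_mkseq.
Qed.

(** The return times of one state form a semigroup with period [p], which contains all large
    multiples of [p]. Any other pair of states is reduced to this one by a detour through that
    state, and [K] is a maximum over the finitely many pairs. *)
Lemma period_exists : exists p K, (0 < p)%N /\ forall x y i j,
  (forall l l', conn (state x i) (state y j) l -> conn (state x i) (state y j) l' ->
     l = l' %[mod p]) /\
  exists2 e, (e <= K)%N & forall m, conn (state x i) (state y j) (e + m * p).
Proof.
pose o := state point 0; pose S l := conn o o l.
have S0 : S 0%N by exists point.
have SD l k : S l -> S k -> S (l + k)%N by exact: conn_cat.
have SM n l : S l -> S (n * l)%N.
  by move=> Sl; elim: n => // n IHn; rewrite mulSn; exact: SD.
(* The period is found as the least positive difference of two return times. *)
pose D d := `[< (0 < d)%N /\ exists2 s, S s & S (s + d)%N >].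
have [l0 Ml0 Sl0] := conn_irreducible point point 0 0.
have exD : exists d, D d.
  exists l0; apply/asboolP; split; first exact: leq_trans Ml0.
  by exists 0%N.
case: (ex_minnP exD) => p /asboolP[p0 [q Sq Sqp]] pmin.
have diff s s' : (s <= s')%N -> S s -> S s' -> (p %| s' - s)%N.
  move=> ss' Ss Ss'; apply: contrapT => /negP; rewrite /dvdn -lt0n => r0.
  (* Otherwise the remainder is a smaller positive difference: with [t] the quotient, it is the
     difference of the return times [s' + t q] and [s + t (q + p)]. *)
  have : D ((s' - s) %% p)%N.
    apply/asboolP; split=> //.
    exists (s + (s' - s) %/ p * (q + p))%N; first by apply: SD => //; exact: SM.
    rewrite (_ : (_ + _)%N = (s' + (s' - s) %/ p * q)%N).
      by apply: SD => //; exact: SM.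
    have := divn_eq (s' - s) p; rewrite mulnDr; lia.
  by move=> /pmin; rewrite leqNgt ltn_mod p0.
have dvdS s : S s -> (p %| s)%N.
  by move=> Ss; have := diff s (s + s)%N (leq_addr _ _) Ss (SD _ _ Ss Ss); rewrite addnK.
have /dvdnP[q' qE] := dvdS _ Sq.
(* Write [m = u q' + v]. For [v < q' <= u], the length [m p] consists of [u - v] loops of length [q]
   and [v] loops of length [q + p]. *)
have large m : (q' * q' <= m)%N -> S (m * p)%N.
  move=> qm; have := divn_eq m q'; set u := (m %/ q')%N; set v := (m %% q')%N => mE.
  rewrite (_ : (m * p)%N = ((u - v) * q + v * (q + p))%N).
    by apply: SD; exact: SM.
  have [q'0|q'0] := posnP q'; first by rewrite mE qE q'0; lia.
  have vq : (v < q')%N by rewrite ltn_mod.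
  have qu : (q' <= u)%N by rewrite leq_divRL.
  by rewrite mulnBl mulnDr addnA subnK ?leq_mul2r ?(ltnW (leq_trans vq qu)) ?orbT// mE qE; lia.
have /choice[e he] : forall ab : {ffun 'I_M -> A} * {ffun 'I_M -> A},
    exists e, forall x y i j, ab = (state x i, state y j) ->
      forall m, conn ab.1 ab.2 (e + m * p).
  move=> [a b]; have [[x [y [i [j abE]]]]|nab] :=
      pselect (exists x y i j, (a, b) = (state x i, state y j)); last first.
    (* Such a pair never occurs, so the value is arbitrary. *)
    by exists 0%N => x y i j abE; case: nab; exists x, y, i, j.
  have [l1 _ c1] := conn_irreducible x point i 0.
  have [l2 _ c2] := conn_irreducible point y 0 j.
  exists (l1 + q' * q' * p + l2)%N => x' y' i' j' _ m; rewrite abE/=.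
  rewrite (_ : (_ + _)%N = (l1 + ((q' * q' + m) * p + l2))%N); last by lia.
  apply: conn_cat c1 _; apply: conn_cat c2; apply: large; exact: leq_addr.
exists p, (\max_ab e ab)%N; split=> // x y i j; split.
  move=> l l' cl cl'.
  have [g _ cg] := conn_irreducible point x 0 i.
  have [h _ ch] := conn_irreducible y point j 0.
  have /dvdS d1 : S (g + (l + h))%N by apply: conn_cat cg _; exact: conn_cat ch.
  have /dvdS d2 : S (g + (l' + h))%N by apply: conn_cat cg _; exact: conn_cat ch.
  have : (g + (l + h) = g + (l' + h) %[mod p])%N.
    by move: d1 d2; rewrite /dvdn => /eqP -> /eqP ->.
  move/eqP; rewrite eqn_modDl eqn_modDr => /eqP //.
exists (e (state x i, state y j)).
  exact: (leq_bigmax (state x i, state y j)).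
by move=> m; exact: (he (state x i, state y j) x y i j erefl m).
Qed.

(* The shift by [j] absorbs the period of [X], which may obstruct the insertion
   of the block of [x] exactly at its original place. *)
Lemma connect_block r : exists k, forall x x' n, exists j z,
  [/\ (`|j| <= k)%N, agree_off (n + k) x' z &
      forall m, (`|(m + j)%R| <= n + r)%N -> seq_of z m = seq_of x (m + j)].
Proof.
have [p [K [p0 hp]]] := period_exists.
pose k := (K + r + M)%N; exists k => x x' n.
(* The path leaves [x'] at [L] and rejoins it at [L + T]: these are the starts of the first and the
   last block of length [M] inside [[-(n + k), n + k]]. *)
pose L : int := - (n + k)%N%:Z; pose T := (2 * (n + k) - M + 1)%N.
have [_ [l1 l1K /(_ 0%N)]] := hp x' x L (- (n + r)%N%:Z).
rewrite mul0n addn0 => c1.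
have [_ [e eK ce]] := hp x x' (n + r)%N%:Z (L + T%:Z).
have cx : conn (state x (- (n + r)%N%:Z)) (state x (n + r)%N%:Z) (2 * (n + r))%N.
  have := conn_state x (- (n + r)%N%:Z) (2 * (n + r))%N.
  by rewrite (_ : - _ + _ = (n + r)%N%:Z)//; lia.
have cT := conn_state x' L T.
have [/(_ _ _ (conn_cat c1 (conn_cat cx (ce 0%N))) cT) congr_e _] :=
  hp x' x' L (L + T%:Z).
(* What remains of the length [T] for the way back. Since [x'] itself is a path of length [T], [l2]
   is congruent to [e] modulo [p], hence an available length. *)
pose l2 := (2 * K + M + 1 - l1)%N.
have TE : T = (l1 + (2 * (n + r) + l2))%N by rewrite /T /l2 /k; lia.
have [t l2E] : exists t, l2 = (e + t * p)%N.
  move: congr_e; rewrite TE mul0n addn0 => /eqP; rewrite !eqn_modDl => /eqP le.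
  have /dvdnP[t tE] : (p %| l2 - e)%N.
    by rewrite -eqn_mod_dvd; [apply/eqP|rewrite /l2; lia].
  by exists t; rewrite -tE subnKC// /l2; lia.
have := ce t; rewrite -l2E => -[z2 [z2c z2d]].
have [z1 [z1a z1b]] := c1.
have [|za [za1 za2]] := @glue x' z1 L 0; first by rewrite z1a.
have [|zb [zb1 zb2]] := @glue za x (L + l1%:Z) (- (n + r)%N%:Z).
  rewrite -z1b; apply/stateP => i iM; rewrite za2; last by lia.
  by congr (seq_of z1 _); lia.
(* The block of [x] that starts at [-(n + r)] is placed at [L + l1]. *)
pose j : int := - L - l1%:Z - (n + r)%N%:Z.
have [|zc [zc1 zc2]] := @glue zb z2 ((n + r)%N%:Z - j) 0.
  rewrite z2c; apply/stateP => i iM; rewrite zb2; last by rewrite /j; lia.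
  by congr (seq_of x _); rewrite /j; lia.
have [|zd [zd1 zd2]] := @glue zc x' (L + T%:Z) (L + T%:Z).
  rewrite -z2d; apply/stateP => i iM; rewrite zc2; last by rewrite /j; lia.
  by congr (seq_of z2 _); rewrite /j; lia.
exists j, zd; split.
- by rewrite /j /L; lia.
- move=> m mnk; have [mL|mL] := ltP m 0.
    by rewrite zd1 ?zc1 ?zb1 ?za1//; rewrite /j ?TE /L; lia.
  by rewrite zd2; [congr (seq_of x' _)|]; rewrite /T /L; lia.
- move=> m mj; rewrite zd1 ?zc1; [|rewrite /j; lia|rewrite TE; lia].
  rewrite zb2; last by rewrite /j in mj; lia.
  by congr (seq_of x _); rewrite /j; lia.
Qed.

(** The block of [x] on [[-N, N]] is closed into a loop by a path from its end back to its
    beginning. The loop returns to the same state, so a block of length [M] across the seam is again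
    a block of [v]. *)
Lemma periodic_point x N : exists (p : nat) z, [/\ (2 * N < p)%N,
  forall m, seq_of z (m + p%:Z) = seq_of z m &
  forall m, (`|m| <= N)%N -> seq_of z m = seq_of x m].
Proof.
have [l Ml [y [ya yb]]] := conn_irreducible x x N.+1%:Z (- N%:Z).
have [|v [v1 v2]] := @glue x y N.+1%:Z 0; first by rewrite ya.
pose p := (2 * N + 1 + l)%N.
have p0 : p%:Z != 0 by rewrite /p; lia.
have vp k : (k < M)%N -> seq_of v (p%:Z - N%:Z + k%:Z) = seq_of v (- N%:Z + k%:Z).
  move=> kM; rewrite v2; last by rewrite /p; lia.
  rewrite v1; last by lia.
  move/stateP: yb => /(_ k kM) <-; congr (seq_of y _); rewrite /p; lia.
pose u : fullShift A := fun m => seq_of v (- N%:Z + ((m + N%:Z) %% p%:Z)%Z).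
have [z zu] : exists z, seq_of z = u.
  apply: point_of; apply: hM => i; pose s := ((i + N%:Z) %% p%:Z)%Z.
  have s0 : 0 <= s by exact: modz_ge0.
  have sp : s < p%:Z by apply: ltz_pmod; rewrite /p; lia.
  have uE m : ((m + N%:Z) %% p%:Z)%Z = ((s + (m - i)) %% p%:Z)%Z.
    by rewrite modzDml; congr modz; lia.
  exists (shift_map (s - i - N%:Z) v) => m mi; rewrite seq_shift /u uE.
  have [lp|pl] := ltP (s + (m - i)) p%:Z.
    by rewrite modz_small; [congr (seq_of v _)|]; lia.
  pose t : int := s + (m - i) - p%:Z.
  have -> : ((s + (m - i)) %% p%:Z)%Z = `|t|%N%:Z.
    rewrite -[s + _](subrK p%:Z) modzDr modz_small; rewrite /t /p; lia.
  by rewrite -vp; [congr (seq_of v _)|]; rewrite /t; lia.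
exists p, z; split; rewrite ?zu.
- by rewrite /p; lia.
- move=> m; rewrite /u (_ : m + p%:Z + N%:Z = m + N%:Z + p%:Z) ?modzDr//; lia.
- move=> m mN; rewrite /u modz_small; last by rewrite /p; lia.
  by rewrite (_ : - _ + _ = m) ?v1//; lia.
Qed.

End Memory.

(** * Exchange of blocks with the same image, and absence of diamonds *)

Section Exchange.
Variables (A B : finType) (X : shiftSpace A) (Y : shiftSpace B).
Variable (pi : factorCode X Y).
Variables (M r : nat).
Hypothesis M0 : (0 < M)%N.
Hypothesis rM : (r <= M)%N.
Hypothesis hM : memory X M.
Hypothesis hr : forall (x x' : X) (m : int),
  (forall i, (`|i - m| <= r)%N -> seq_of x i = seq_of x' i) ->
  seq_of (pi x) m = seq_of (pi x') m.
Implicit Types x y z : X.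

(** The collars are wide enough for the memory [M] and for the coding radius [r]: the image of [z]
    is read off [x] inside the window and off [y] elsewhere. *)
Lemma exchange n x y :
  (forall m, (n < `|m| + r)%N -> (`|m| <= n + M)%N -> seq_of x m = seq_of y m) ->
  agree n (seq_of (pi x)) (seq_of (pi y)) ->
  exists z, [/\ forall m, (`|m| <= n + M)%N -> seq_of z m = seq_of x m,
    agree_off n y z & pi z = pi y].
Proof.
move=> xy pxy; have [m /andP[nm mnM]|z [zx zy]] := @patch_point _ _ M M0 hM n x y.
  by apply: xy => //; lia.
exists z; split=> //; apply: eq_point => m; have [mn|nm] := leqP `|m| n.
  by rewrite -pxy//; apply: hr => i im; apply: zx; lia.
apply: hr => i im; have [iM|Mi] := leqP `|i| (n + M).
  by rewrite zx// xy//; lia.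
by rewrite zy//; lia.
Qed.

Hypothesis irr : irreducible X.
Hypothesis fin : finite_to_one pi.

(* A diamond, repeated at one of infinitely many places of a periodic point,
   would give infinitely many points with the same image. *)
Lemma no_diamond N x y : agree_off N x y -> pi x = pi y -> x = y.
Proof.
move=> xy pxy; apply: contrapT => nxy.
have [m0 xym0] : exists m, seq_of x m <> seq_of y m.
  by apply: contrapT => /forallNP h; apply: nxy; apply: eq_point => m; exact: contrapT (h m).
have m0N : (`|m0| <= N)%N by rewrite leqNgt; apply/negP => /xy.
pose n := (N + r)%N.
have [p [z [pn zp zx]]] := periodic_point M0 hM irr x (n + M).
have [m nm mM|m mn|z' [z'y z'z pz]] := @exchange n y z.
- by rewrite zx// xy//; lia.
- rewrite -pxy; apply/esym; apply: hr => i im; apply: zx; lia.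
have zpn q m : seq_of z (m + (q * p)%N%:Z) = seq_of z m.
  elim: q m => [|q IHq] m; first by rewrite mul0n addr0.
  by rewrite mulSn (_ : m + _ = m + (q * p)%N%:Z + p%:Z) ?zp//; lia.
(* Each [g q] differs from the periodic point [z] only near [-q p], where it carries the block of
   [y]; the periodicity of [z] makes all images equal, and [p] is large enough to keep the places
   apart. *)
pose g q := shift_map (q * p)%N%:Z z'.
have gpi q : pi (g q) = pi z.
  rewrite factor_shift pz -factor_shift; congr (pi _).
  by apply: eq_point => m; rewrite seq_shift zpn.
have ginj q q' : (q < q')%N -> g q <> g q'.
  move=> qq' gE; have := congr1 (fun a => seq_of a (m0 - (q * p)%N%:Z)) gE.
  have qp : (p <= (q' - q) * p)%N by rewrite leq_pmull// subn_gt0.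
  rewrite mulnBl in qp.
  have [d dE] : exists d, (q' * p = q * p + d * p)%N.
    by exists (q' - q)%N; rewrite -mulnDl subnKC// ltnW.
  have dp : (p <= d * p)%N by lia.
  rewrite !seq_shift subrK (_ : _ - _ + _ = m0 + (d * p)%N%:Z); last by lia.
  rewrite z'y; last by lia.
  rewrite -z'z; last by lia.
  by rewrite zpn zx; [exact/nesym|lia].
have : finite_set (g @^-1` (pi @^-1` [set pi z])).
  apply: finite_preimage; last exact: fin.
  move=> q q' _ _ /= gE; apply: contrapT => /eqP; rewrite neq_ltn => /orP[] h.
    exact: ginj h gE.
  exact: ginj h (esym gE).
rewrite (_ : _ @^-1` _ = setT); first exact: infinite_nat.
by apply/seteqP; split=> // q _ /=.
Qed.

End Exchange.

(** * Holonomies *)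

Section FinitePartition.
Variables (R : realType) (d : measure_display) (T : measurableType d).
Variables (P : {measure set T -> \bar R}) (I : finType) (g : T -> I).
Hypothesis mg : forall i, measurable (g @^-1` [set i]).

Lemma measure_partition (S : set T) : measurable S ->
  P S = (\sum_(i : I) P (S `&` g @^-1` [set i]))%E.
Proof.
move=> mS.
have mSg i : measurable (S `&` g @^-1` [set i]) by exact: measurableI.
suff h (s : seq I) : uniq s -> measurable (S `&` g @^-1` [set` s]) /\
    P (S `&` g @^-1` [set` s]) = (\sum_(i <- s) P (S `&` g @^-1` [set i]))%E.
  have [_] := h (index_enum I) (index_enum_uniq I).
  rewrite (_ : _ `&` _ = S)//; apply/seteqP; split=> [x []//|x Sx].
  by split=> //=; rewrite mem_index_enum.
elim: s => [_|i s IHs /= /andP[nis us]].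
  rewrite big_nil (_ : _ `&` _ = set0); last by apply/seteqP; split=> // x [].
  by rewrite measure0.
have [ms Ps] := IHs us.
have -> : S `&` g @^-1` [set` i :: s] =
    (S `&` g @^-1` [set i]) `|` (S `&` g @^-1` [set` s]).
  apply/seteqP; split=> x /=.
    by rewrite inE => -[Sx /orP[/eqP gx|gx]]; [left|right].
  by move=> [[Sx ->]|[Sx gs]]; rewrite inE ?eqxx ?gs ?orbT.
split; first exact: measurableU.
rewrite measureU//; first by rewrite big_cons -Ps.
apply/seteqP; split=> // x [[_ /= gx] [_ /=]].
by rewrite gx (negbTE nis).
Qed.

End FinitePartition.

Section Holonomy.
Variables (A : finType) (X : shiftSpace A).
Implicit Types (E F : set (borel X)) (psi : borel X -> borel X).

Lemma holonomy_image E F psi : holonomy E F psi -> psi @` E = F.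
Proof.
move=> [_ _ [psi' [EF FE _ K _]] _]; apply/seteqP; split=> y.
  by move=> [x /EF Fx <-].
by move=> Fy; exists (psi' y); [exact: FE|rewrite K ?inE].
Qed.

Lemma holonomy_inv E F psi : holonomy E F psi -> exists psi',
  [/\ holonomy F E psi', forall x, E x -> psi' (psi x) = x &
      forall y, F y -> psi (psi' y) = y].
Proof.
move=> [mE mF [psi' [EF FE K K' [m m']]] g]; exists psi'; split.
- split=> //; first by exists psi.
  move=> y Fy; apply: gibbs_rel_sym; rewrite -{2}[y]K' ?inE//; apply: g; exact: FE.
- by move=> x Ex; rewrite K ?inE.
- by move=> y Fy; rewrite K' ?inE.
Qed.

Lemma holonomy_restr E F psi G : holonomy E F psi -> measurable G -> G `<=` E ->
  holonomy G (psi @` G) psi.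
Proof.
move=> h mG GE; have [mE mF [psi' [EF FE K K' [m m']]] g] := h.
have imE : psi @` G = F `&` psi' @^-1` G.
  apply/seteqP; split=> y.
    move=> [x Gx <-]; split; first exact/EF/GE.
    by rewrite /= K ?inE//; exact: GE.
  by move=> [Fy Gy]; exists (psi' y) => //; rewrite K' ?inE.
have GF : psi @` G `<=` F by rewrite imE => y [].
have mpG : measurable (psi @` G) by rewrite imE; exact: m'.
split=> //; last by move=> x /GE; exact: g.
exists psi'; split.
- by move=> x Gx; exists x.
- by rewrite imE => y [].
- by move=> x; rewrite inE => /GE Ex; rewrite K ?inE.
- by move=> y; rewrite inE => /GF Fy; rewrite K' ?inE.
- by split; [exact: measurable_funS m|exact: measurable_funS m'].
Qed.

Lemma holonomy_comp E F G psi chi : holonomy E F psi -> holonomy F G chi ->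
  holonomy E G (chi \o psi).
Proof.
move=> [mE mF [psi' [EF FE K1 K1' [m1 m1']]] g1].
move=> [_ mG [chi' [FG GF K2 K2' [m2 m2']]] g2].
split=> //; last first.
  by move=> x Ex; apply: gibbs_rel_trans (g1 _ Ex) _; apply: g2; exact: EF.
exists (psi' \o chi'); split.
- by move=> x /EF/FG.
- by move=> x /GF/FE.
- move=> x; rewrite inE => Ex /=; rewrite K2 ?K1 ?inE//; exact: EF.
- move=> x; rewrite inE => Ex /=; rewrite K1' ?K2' ?inE//; exact: GF.
- by split; [apply: measurable_comp m2 m1 => //|apply: measurable_comp m1' m2' => //];
    move=> _ [x Ex <-]; [exact: EF|exact: GF].
Qed.

Definition patch_seq (N : nat) (u x : fullShift A) : fullShift A :=
  fun m => if (`|m| <= N)%N then u m else x m.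

(** The point [x] is kept when the patched sequence leaves [X], which makes the map total. *)
Definition swap (N : nat) (u x : X) : X :=
  match pselect (shift_set X (patch_seq N (seq_of u) (seq_of x))) with
  | left Xu => exist _ (patch_seq N (seq_of u) (seq_of x)) (mem_set Xu)
  | right _ => x
  end.

Lemma seq_swap N u x : shift_set X (patch_seq N (seq_of u) (seq_of x)) ->
  seq_of (swap N u x) = patch_seq N (seq_of u) (seq_of x).
Proof. by rewrite /swap; case: pselect. Qed.

Lemma swap_off N u x : agree_off N x (swap N u x).
Proof.
move=> m mN.
have [Xu|nXu] := pselect (shift_set X (patch_seq N (seq_of u) (seq_of x))).
  by rewrite seq_swap// /patch_seq leqNgt mN.
by rewrite /swap; case: pselect.
Qed.

(** As [X] is closed, it suffices that every central window of the patched sequence occurs in [X]: a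
    countable intersection of window sets. *)
Lemma measurable_patch N (u : X) :
  measurable ([set x : X | shift_set X (patch_seq N (seq_of u) (seq_of x))] : set (borel X)).
Proof.
rewrite (_ : mkset _ = \bigcap_q
    [set x : X | exists z : X, agree q (patch_seq N (seq_of u) (seq_of x)) (seq_of z)]).
  apply: bigcapT_measurable => q; apply: (@measurable_window _ _ q) => x y xy [z hz].
  exists z; apply: agree_trans hz => m mq; rewrite /patch_seq; case: ifP => // _.
  by rewrite xy.
apply/seteqP; split=> x /=.
  by move=> /point_of[z zE] q _; exists z; rewrite zE.
by move=> h; apply: closure_agree => q; exact: h.
Qed.

Lemma measurable_window_swap N (u : X) : measurable_fun setT (swap N u : borel X -> borel X).
Proof.
apply: measurable_fun_window => // k S wS; rewrite setTI.
pose D : set (borel X) := [set x : X | shift_set X (patch_seq N (seq_of u) (seq_of x))].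
pose S' : set (borel X) :=
  [set x : X | exists2 z : X, S z & agree k (patch_seq N (seq_of u) (seq_of x)) (seq_of z)].
have mD : measurable D by exact: measurable_patch.
rewrite (_ : _ @^-1` _ = (D `&` S') `|` (~` D `&` S)).
  apply: measurableU; apply: measurableI => //.
  - apply: (@measurable_window _ _ k) => x y xy [z Sz hz]; exists z => //.
    apply: agree_trans hz => m mq; rewrite /patch_seq; case: ifP => // _.
    by rewrite xy.
  - exact: measurableC.
  - exact: measurable_window wS.
apply/seteqP; split=> x /=; rewrite /swap; case: pselect => Dx.
- by move=> h; left; split=> //; eexists; [exact: h|].
- by move=> h; right.
- move=> [[_ [z Sz hz]]|[]//]; apply: wS Sz; exact: agree_sym.
- by move=> [[]//|[]].
Qed.

(** All points of [E] carry the block of [v], so writing this block back is the inverse. *)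
Lemma swap_holonomy N (u v : X) E : measurable E ->
  (forall x, E x -> agree N (seq_of v) (seq_of x)) ->
  (forall x, E x -> shift_set X (patch_seq N (seq_of u) (seq_of x))) ->
  holonomy E (cyl N u `&` swap N v @^-1` E) (swap N u).
Proof.
move=> mE Ev Eu; pose F : set (borel X) := cyl N u `&` swap N v @^-1` E.
have swE x : E x -> swap N v (swap N u x) = x.
  move=> Ex.
  have pE : patch_seq N (seq_of v) (seq_of (swap N u x)) = seq_of x.
    rewrite seq_swap; last exact: Eu.
    apply/funext => m; rewrite /patch_seq; case: leqP => mN //.
    exact: (Ev _ Ex).
  by apply: seq_of_inj; rewrite seq_swap pE//; exact: mem_seq_of.
have swF y : F y -> swap N u (swap N v y) = y.
  move=> [uy] /=.
  have [Dy Ex|Dy] := pselect (shift_set X (patch_seq N (seq_of v) (seq_of y))).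
    apply: seq_of_inj; apply/funext => m; rewrite seq_swap; last exact: Eu.
    rewrite /patch_seq; case: leqP => mN; first exact: uy.
    by apply/esym; exact: swap_off.
  (* If the block of [v] cannot be written, then [swap N v y] is [y], which lies in [E] and already
     carries this block: a contradiction. *)
  rewrite {1}/swap; case: pselect => // _ Ey; exfalso; apply: Dy.
  rewrite (_ : patch_seq _ _ _ = seq_of y); first exact: mem_seq_of.
  by apply/funext => m; rewrite /patch_seq; case: ifP => // mN; rewrite (Ev _ Ey).
have mF : measurable F.
  apply: measurableI; first by apply: measurable_window; exact: window_cyl.
  by rewrite -[X in measurable X]setTI; exact: measurable_window_swap.
split=> //; last first.
  by move=> x Ex; apply/gibbs_relP; exists N; exact: swap_off.
exists (swap N v); split.
- move=> x Ex; split; last by rewrite /= swE.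
  by move=> m mN; rewrite seq_swap ?/patch_seq ?mN//; exact: Eu.
- by move=> y [].
- by move=> x; rewrite inE; exact: swE.
- by move=> y; rewrite inE; exact: swF.
- by split; apply: measurable_funS (measurable_window_swap _ _).
Qed.

End Holonomy.

(** * Measurability and invariance for all powers of the shift *)

Section ShiftMeasure.
Variables (A : finType) (X : shiftSpace A).

Lemma measurable_shift n : measurable_fun setT (shift_map n : borel X -> borel X).
Proof.
apply: measurable_fun_window => // k S wS; rewrite setTI.
apply: (@measurable_window _ _ (k + `|n|)) => x y xy; apply: wS => m mk.
by rewrite !seq_shift xy//; lia.
Qed.

Lemma measurable_shift_preimage n (E : set (borel X)) :
  measurable E -> measurable ((shift_map n : borel X -> borel X) @^-1` E).
Proof. by move=> mE; rewrite -[X in measurable X]setTI; exact: measurable_shift. Qed.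

Lemma shift_invariant_int (R : realType) (P : probability (borel X) R) n
    (E : set (borel X)) : shift_invariant P -> measurable E ->
  P ((shift_map n : borel X -> borel X) @^-1` E) = P E.
Proof.
move=> inv.
have pos (k : nat) G : measurable G ->
    P ((shift_map k%:Z : borel X -> borel X) @^-1` G) = P G.
  elim: k G => [|k IHk] G mG.
    by congr (P _); apply/seteqP; split=> x /=; rewrite shift_map0.
  rewrite -(IHk _ mG) -(inv ((shift_map k : borel X -> borel X) @^-1` G)); last first.
    exact: measurable_shift_preimage.
  congr (P _); apply/seteqP; split=> x /=; rewrite shift_mapD;
    by rewrite (_ : k.+1%:Z = k%:Z + 1)//; lia.
case: n => k mE; first exact: pos.
rewrite -(pos k.+1); last exact: measurable_shift_preimage.
congr (P _); apply/seteqP; split=> x /=; rewrite shift_mapD NegzE addNr shift_map0//.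
Qed.

End ShiftMeasure.

Section GibbsBound.
Variables (R : realType) (A : finType) (X : shiftSpace A).

Lemma gibbs_measure_le (phi : X -> X -> R) (mu : probability (borel X) R)
    (E F : set (borel X)) psi (a : R) :
  gibbs_measure phi mu -> holonomy E F psi ->
  (forall x, E x -> phi x (psi x) <= a) ->
  (mu F <= (expR a)%:E * mu E)%E.
Proof.
move=> [_ hmu] hol le_a; have [g [mg g0 gE] ae_g] := hmu _ _ _ hol.
have [mE mF _ _] := hol.
rewrite -(holonomy_image hol) gE//.
rewrite -integral_cst//; apply: ae_ge0_le_integral => //.
- by move=> x _ ; rewrite lee_fin expR_ge0.
- by apply: filterS ae_g => x hx Ex; rewrite hx// lee_fin ler_expR le_a.
Qed.

End GibbsBound.

(** * Comparison of cylinders *)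

Section Pushforward.
Variables (R : realType) (A B : finType) (X : shiftSpace A) (Y : shiftSpace B).
Variables (pi : factorCode X Y) (mu : probability (borel X) R).

Lemma measurable_factor_preimage (S : set (borel Y)) :
  measurable S -> measurable ((pi : borel X -> borel Y) @^-1` S).
Proof. by move=> mS; rewrite -[X in measurable X]setTI; exact: factor_measurable. Qed.

Lemma factor_imageE (S : set (borel Y)) :
  factor_image pi mu S = mu ((pi : borel X -> borel Y) @^-1` S).
Proof. by []. Qed.

Lemma factor_image_invariant : shift_invariant mu -> shift_invariant (factor_image pi mu).
Proof.
move=> inv E mE; rewrite !factor_imageE.
rewrite -(inv _ (measurable_factor_preimage mE)); congr (mu _).
by apply/seteqP; split=> x /=; rewrite factor_shift.
Qed.

Lemma potential_cocycle_factor (f : Y -> R) x x' :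
  potential_cocycle (fun x : X => f (pi x)) x x' = potential_cocycle f (pi x) (pi x').
Proof.
by congr sumZ; apply/funext => n; rewrite !factor_shift.
Qed.

End Pushforward.

Section CylinderBound.
Variables (R : realType) (A B : finType) (X : shiftSpace A) (Y : shiftSpace B).
Variables (X_sft : finite_type X) (X_irr : irreducible X).
Variables (pi : factorCode X Y) (pi_fin : finite_to_one pi).
Variables (f : Y -> R) (w : nat -> R) (W : R).
Hypothesis fw : modulus f w W.
Variable mu : probability (borel X) R.
Hypothesis mu_inv : shift_invariant mu.
Hypothesis mu_gibbs : gibbs_for_potential (fun x : X => f (pi x)) mu.
Let nu := factor_image pi mu.

(* A point of [X] over [y'] is replaced near the window by a point over (a
   translate of) [y]; the no-diamond property bounds the number of points over
   the block of [y'] in terms of their behaviour close to the ends of the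
   window. *)
Lemma cylinder_bound : exists2 C : R, 0 < C & forall n (y y' : Y),
  agree_off n y y' ->
  (nu (cyl n y') <= (C * expR (potential_cocycle f y y'))%:E * nu (cyl n y))%E.
Proof.
have [r hr] := block_code pi.
have [M1 hM1] := finite_type_memory X_sft.
pose M := (maxn M1 r).+1.
have hM : memory X M by apply: memoryW hM1; rewrite leqW// leq_maxl.
have rM : (r <= M)%N by rewrite leqW// leq_maxr.
have M0 : (0 < M)%N by [].
have [k hk] := connect_block M0 hM X_irr r.
(* The [K] outermost places at each end of [[-N, N]], with [N = n + k + M], include all places with
   [n < |m| + r]; [key] records their symbols. *)
pose K := (k + M + r)%N.
pose C0 := ((w 0%N *+ K + W) *+ 4 + w 0%N *+ K) *+ 2.
pose I := {ffun 'I_K -> A * A}.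
(* Each key contributes [expR C0]; the successor makes the constant visibly positive. *)
exists (#|I|.+1%:R * expR C0); first by rewrite mulr_gt0 ?expR_gt0.
move=> n y y' yy'; pose N := (n + k + M)%N.
have mcyl (z : Y) : measurable (cyl n z : set (borel Y)).
  by apply: measurable_window; exact: window_cyl.
pose D : set (borel X) := (pi : borel X -> borel Y) @^-1` cyl n y'.
have mD : measurable D by exact: measurable_factor_preimage.
pose key (x : borel X) : I := [ffun i : 'I_K =>
  ((seq_of x (N%:Z - i%:Z) : A), (seq_of x (i%:Z - N%:Z) : A))].
have mkey i : measurable (key @^-1` [set i]).
  apply: (@measurable_window _ _ (N + K)) => x1 x2 x12 /= <-.
  by apply/ffunP => j; rewrite !ffunE; congr (_, _); apply/esym/x12;
    have := ltn_ord j; lia.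
have keyP x1 x2 : key x1 = key x2 -> forall m, (n < `|m| + r)%N -> (`|m| <= N)%N ->
    seq_of x1 m = seq_of x2 m.
  move=> /ffunP kE m nm mN.
  have iK : (N - `|m| < K)%N by rewrite /N /K; lia.
  have := kE (Ordinal iK); rewrite !ffunE /= => -[e1 e2].
  have [m0|m0] := leP 0 m.
    by move: e1; rewrite (_ : _ - _ = m)//; lia.
  by move: e2; rewrite (_ : _ - _ = m)//; lia.
(* Exchanging the central block of [x2] for that of [x1] keeps the image, so it gives [x2] back for
   lack of diamonds. *)
have agreeN x1 x2 : D x1 -> D x2 -> key x1 = key x2 ->
    agree N (seq_of x1) (seq_of x2).
  move=> D1 D2 /keyP k12.
  have [m nm mM||z [z1 z2 pz]] := @exchange _ _ _ _ pi M r M0 rM hM hr n x1 x2.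
  - by apply: k12 => //; rewrite /N; lia.
  - exact: agree_trans (agree_sym D1) D2.
  have zE := no_diamond M0 rM hM hr X_irr pi_fin z2 (esym pz).
  move=> m mN; have [mn|nm] := leqP `|m| n; last by apply: k12 => //; lia.
  by rewrite zE z1//; lia.
have piece i : (mu (D `&` key @^-1` [set i]) <=
    (expR C0 * expR (potential_cocycle f y y'))%:E * nu (cyl n y))%E.
  have [->|/set0P[x' [Dx' kx']]] := eqVneq (D `&` key @^-1` [set i]) set0.
    by rewrite measure0 mule_ge0// lee_fin mulr_ge0 ?expR_ge0.
  have [x px] := @factor_surjective _ _ _ _ pi y.
  have [j [z [jk x'z zx]]] := hk x x' n.
  set E := D `&` key @^-1` [set i].
  have mE : measurable E by exact: measurableI.
  have Ex' x1 : E x1 -> agree N (seq_of x') (seq_of x1).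
    by move=> [D1 k1]; apply: agreeN => //; rewrite kx' k1.
  have Ez x1 : E x1 -> shift_set X (patch_seq N (seq_of z) (seq_of x1)).
    move=> Ex1; have [m /andP[mn mN]|v [v1 v2]] := @patch_point _ _ M M0 hM (n + k) z x1.
      by rewrite -x'z ?(Ex' _ Ex1)//; rewrite /N; lia.
    rewrite (_ : patch_seq _ _ _ = seq_of v); first exact: mem_seq_of.
    apply/funext => m; rewrite /patch_seq; case: leqP => mN; first by rewrite v1.
    by rewrite v2//; rewrite /N in mN; lia.
  have hol := swap_holonomy mE Ex' Ez.
  have [psi [holi _ psiK]] := holonomy_inv hol.
  have [mF _ [_ [psiE _ _ _ _]] _] := holi.
  (* The Gibbs bound is used for the inverse holonomy, from [F], which lies over a translate of the
     block of [y], to [E], which lies over the block of [y']. *)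
  pose F := cyl N z `&` swap N x' @^-1` E.
  have zF x1 : F x1 -> forall m : int, (`|(m + j)%R| <= n)%N ->
      seq_of (pi x1) m = seq_of y (m + j).
    move=> [zx1 _] m mj; rewrite -px -seq_shift -factor_shift.
    apply: hr => l lm; rewrite seq_shift -zx; last by lia.
    by rewrite zx1// /N; lia.
  apply: (@le_trans _ _ ((expR (C0 + potential_cocycle f y y'))%:E * mu F)%E).
    apply: (gibbs_measure_le mu_gibbs holi) => x1 Fx1.
    rewrite potential_cocycle_factor.
    have Epsi : E (psi x1) by exact: psiE.
    have off : agree_off (n + k) x1 (psi x1).
      move=> m mnk; have [mN|Nm] := leqP `|m| N.
        by rewrite -(Ex' _ Epsi m mN) x'z// (proj1 Fx1 m mN).
      by rewrite -{1}(psiK _ Fx1) (@swap_off _ _ N z (psi x1)).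
    have := @cocycle_compare _ _ _ _ _ _ fw K n j (pi x1) (pi (psi x1)) y y'.
    move=> /(_ _ _ yy' _ (zF _ Fx1)) h.
    have : `|potential_cocycle f (pi x1) (pi (psi x1)) - potential_cocycle f y y'| <= C0.
      apply: h; first by rewrite /K; lia.
        move=> m mK; apply: hr => l lm; apply: off; rewrite /K in mK; lia.
      by apply: agree_sym; case: Epsi.
    by rewrite ler_norml => /andP[_]; rewrite lerBlDr.
  rewrite expRD lee_pmul2l//; last by rewrite lte_fin mulr_gt0// expR_gt0.
  (* Invariance removes the translation by [j]. *)
  rewrite -(shift_invariant_int (- j) (factor_image_invariant pi mu_inv) (mcyl y)).
  apply: le_measure; rewrite ?inE//.
    by apply: measurable_factor_preimage; exact: measurable_shift_preimage.
  move=> x1 /zF h m mn; rewrite seq_shift h subrK//.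
rewrite /nu factor_imageE -/D.
rewrite (measure_partition mu mkey mD).
apply: (@le_trans _ _ (\sum_(i : I) (expR C0 * expR (potential_cocycle f y y'))%:E * nu (cyl n y))%E).
  by apply: lee_sum => i _; exact: piece.
have -> : nu (cyl n y) = (fine (nu (cyl n y)))%:E.
  by rewrite fineK// fin_num_measure.
rewrite -!EFinM sumEFin lee_fin sumr_const -[leLHS]mulr_natl.
rewrite -!mulrA; apply: ler_wpM2r; last by rewrite ler_nat leqnSn.
by rewrite !mulr_ge0 ?expR_ge0 ?fine_ge0.
Qed.

End CylinderBound.

(** * From cylinders to holonomies *)

Section FiniteMeasures.
Variables (R : realType) (d : measure_display) (T : measurableType d).

(** The cover is made disjoint, and countable additivity is used on both sides. Comparisons of
    measures thereby become local. *)
Lemma cover_le (l n : {measure set T -> \bar R}) (c : R) (E : set T)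
    (F : (set T)^nat) : 0 <= c -> measurable E -> (forall i, measurable (F i)) ->
  E `<=` \bigcup_i F i ->
  (forall i G, measurable G -> G `<=` E -> G `<=` F i -> (l G <= c%:E * n G)%E) ->
  (l E <= c%:E * n E)%E.
Proof.
move=> c0 mE mF EF h; pose G i := E `&` seqDU F i.
have mG i : measurable (G i) by apply: measurableI => //; exact: seqDU_measurable.
have tG : trivIset setT G by apply: trivIset_setIl; exact: trivIset_seqDU.
have -> : E = \bigcup_i G i.
  by rewrite -setI_bigcupr -seqDU_bigcup_eq setIidl.
have mUG : measurable (\bigcup_i G i) by exact: bigcupT_measurable.
rewrite !measure_semi_bigcup// -nneseriesZl//.
apply: lee_nneseries => [i _ _|i _]; first exact: measure_ge0.
by apply: (h i) => // x [Ex Fx] //; exact: subset_seqDU Fx.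
Qed.

(** An alias that carries the proof of finiteness, so that the structure of a charge can be attached
    to it. *)
Definition finite_charge (m : {measure set T -> \bar R}) (_ : fin_num_fun m) :
  set T -> \bar R := m.

HB.instance Definition _ (m : {measure set T -> \bar R}) (hm : fin_num_fun m) :=
  isCharge.Build _ T R (finite_charge hm) (measure0 m) hm
    (@measure_semi_sigma_additive _ _ _ m).

(** This is the Hahn decomposition of the signed measure [l - t n]. *)
Lemma Hahn_le (l n : {measure set T -> \bar R}) (t : R) :
  fin_num_fun l -> fin_num_fun n ->
  exists P, [/\ measurable P,
    forall G, measurable G -> G `<=` P -> (t%:E * n G <= l G)%E &
    forall G, measurable G -> G `<=` ~` P -> (l G <= t%:E * n G)%E].
Proof.
move=> lfin nfin.
pose c := cadd (finite_charge lfin) (cscale (- t) (finite_charge nfin)).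
have cE G : c G = (l G - t%:E * n G)%E.
  rewrite /c /cadd /= /cscale /finite_charge /=.
  by rewrite EFinN mulNe.
have [P [N [[mP hP] [mN hN] PN PN0]]] := Hahn_decomposition c.
have tfin G : measurable G -> (t%:E * n G)%E \is a fin_num.
  by move=> mG; rewrite fin_numM// nfin.
exists P; split=> // G mG GP.
  by have := hP G mG GP; rewrite -[X in (_ <= X)%E]/(c G) cE sube_ge0// tfin.
have := hN G mG; rewrite -[X in (X <= _)%E]/(c G) cE sube_le0; apply.
move=> x Gx; have [Px|//] : (P `|` N) x by rewrite PN.
by have := GP _ Gx.
Qed.

End FiniteMeasures.

(** * Image measures of holonomies and their decomposition into block changes *)

Section HolonomyMeasure.
Variables (R : realType) (A : finType) (X : shiftSpace A).
Variable (nu : probability (borel X) R).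
Implicit Types (E F G : set (borel X)) (psi : borel X -> borel X).

Lemma holonomy_measure E F psi : holonomy E F psi ->
  exists2 l : {measure set (borel X) -> \bar R}, fin_num_fun l &
    forall G, measurable G -> G `<=` E -> l G = nu (psi @` G).
Proof.
move=> hol; have [mE mF [psi' [EF FE K K' [m m']]] g] := hol.
pose q (y : borel X) : borel X := if y \in F then psi' y else y.
have mq : measurable_fun setT q.
  move=> _ S mS; rewrite setTI.
  rewrite (_ : q @^-1` S = (F `&` psi' @^-1` S) `|` (~` F `&` S)).
    by apply: measurableU; [exact: m'|apply: measurableI => //; exact: measurableC].
  apply/seteqP; split=> y; rewrite /q /=.
    by case: ifPn; [rewrite inE; left|rewrite notin_setE; right].
  by move=> [[Fy Sy]|[Fy Sy]]; [rewrite mem_set|rewrite memNset].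
unshelve eexists (pushforward (mrestr nu mF) q : {measure set (borel X) -> \bar R}).
- exact: mq.
- move=> G mG /=; rewrite /pushforward /mrestr fin_num_measure//.
  apply: measurableI => //; rewrite -[X in measurable X]setTI; exact: mq.
move=> G mG GE /=; rewrite /pushforward /mrestr; congr (nu _).
apply/seteqP; split=> y.
  move=> [/= + Fy]; rewrite /q mem_set// => Gy; exists (psi' y) => //.
  by rewrite K' ?inE.
move=> [x Gx <-]; have Ex := GE _ Gx; split; last exact: EF.
by rewrite /= /q mem_set ?K ?inE//; exact: EF.
Qed.

(** Only upper bounds are required; lower bounds come from the inverse holonomy. *)
Definition holonomy_bound (phi : X -> X -> R) (c : R) : Prop :=
  forall E F psi a, holonomy E F psi -> (forall x, E x -> phi x (psi x) <= a) ->
    (nu F <= (c * expR a)%:E * nu E)%E.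

Lemma measurable_eq_coord E psi m : measurable E -> measurable_fun E psi ->
  measurable (E `&` [set x | seq_of x m = seq_of (psi x) m]).
Proof.
move=> mE mpsi.
rewrite (_ : _ `&` _ = \bigcup_(b in [set: A]) ((E `&` [set x | seq_of x m = b]) `&`
    (E `&` psi @^-1` [set x | seq_of x m = b]))).
  apply: fin_bigcup_measurable => [|b _]; first exact: finite_finset.
  apply: measurableI; last by apply: mpsi => //; exact: measurable_coord.
  by apply: measurableI => //; exact: measurable_coord.
apply/seteqP; split=> x.
  by move=> [Ex /= xE]; exists (seq_of x m) => //; split; split.
by move=> [b _ [[Ex /= xb] [_ /= pb]]]; split=> //=; rewrite xb pb.
Qed.

Lemma measurable_agree_off E psi N : measurable E -> measurable_fun E psi ->
  measurable (E `&` [set x | agree_off N x (psi x)]).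
Proof.
move=> mE mpsi.
rewrite (_ : _ `&` _ = \bigcap_k
   ((E `&` [set x | seq_of x (N + k).+1%:Z = seq_of (psi x) (N + k).+1%:Z]) `&`
    (E `&` [set x | seq_of x (- (N + k).+1%:Z) = seq_of (psi x) (- (N + k).+1%:Z)]))).
  apply: bigcapT_measurable => k.
  by apply: measurableI; exact: measurable_eq_coord.
apply/seteqP; split=> x.
  move=> [Ex /= h] k _; split; split=> //=; apply: h; lia.
move=> h; split; first by have [[]] := h 0%N I.
move=> m mN; have [[_ /= h1] [_ /= h2]] := h (`|m| - N.+1)%N I.
have [m0|m0] := leP 0 m.
  by move: h1; rewrite (_ : Posz _ = m)//; lia.
by move: h2; rewrite (_ : - Posz _ = m)//; lia.
Qed.

Definition word N (x : X) : seq A :=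
  mkseq (fun t : nat => (seq_of x (t%:Z - N%:Z) : A)) (N + N).+1.

Lemma wordP N x y : word N x = word N y <-> agree N (seq_of x) (seq_of y).
Proof.
split=> [h m mN|h].
  have := congr1 (fun s => nth (seq_of x 0) s (absz (m + N%:Z))) h.
  rewrite !nth_mkseq; [|lia|lia].
  by rewrite (_ : _ - _ = m)//; lia.
apply: (@eq_from_nth _ (seq_of x 0)); rewrite !size_mkseq// => i iN.
rewrite !nth_mkseq//; apply: h; lia.
Qed.

(** The pieces are indexed by codes of a radius and two words: on each of them [psi] replaces one
    fixed block by another. *)
Lemma holonomy_pieces E F psi : holonomy E F psi ->
  exists P : (set (borel X))^nat, [/\ forall i, measurable (P i),
    E `<=` \bigcup_i P i &
    forall i, exists N, forall x y, P i x -> P i y ->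
      [/\ agree_off N x (psi x), agree N (seq_of x) (seq_of y) &
          agree N (seq_of (psi x)) (seq_of (psi y))]].
Proof.
move=> [mE mF [psi' [_ _ _ _ [mpsi _]]] g].
pose P i : set (borel X) := if (unpickle i : option (nat * (seq A * seq A)%type)) is
  Some (N, (s, s')) then (E `&` [set x | agree_off N x (psi x)]) `&`
     ([set x | word N x = s] `&` (E `&` psi @^-1` [set x | word N x = s'])) else set0.
have mword N s : measurable ([set x | word N x = s] : set (borel X)).
  by apply: (@measurable_window _ _ N) => x y /wordP xy /= <-.
exists P; split.
- move=> i; rewrite /P; case: unpickle => [[N [s s']]|]; last exact: measurable0.
  apply: measurableI; first exact: measurable_agree_off.
  by apply: measurableI => //; apply: mpsi.
- move=> x Ex; have /gibbs_relP[N xN] := g _ Ex.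
  by exists (pickle (N, (word N x, word N (psi x)))) => //; rewrite /P pickleK.
- move=> i; rewrite /P; case: unpickle => [[N [s s']]|]; last by exists 0%N.
  exists N => x y [[_ /= xN] [/= xs [_ /= xs']]] [_ [/= ys [_ /= ys']]].
  by split=> //; apply/wordP; [rewrite xs ys|rewrite xs' ys'].
Qed.

Definition cylinder_bounded (phi : X -> X -> R) (c : R) : Prop :=
  forall n (y y' : X), agree_off n y y' ->
    (nu (cyl n y') <= (c * expR (phi y y'))%:E * nu (cyl n y))%E.

(** On a piece and for large [q], points in a common [q]-cylinder have images in a common
    [q]-cylinder. Outer regularity keeps the total measure of the cylinders that are used close to
    [nu G]. *)
Lemma cylinder_holonomy_bound phi c : 0 < c -> cylinder_bounded phi c ->
  holonomy_bound phi c.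
Proof.
move=> c0 hc E F psi a hol le_a.
have [mE mF _ _] := hol.
have [l lfin lE] := holonomy_measure hol.
have [P [mP EP PN]] := holonomy_pieces hol.
pose c' := c * expR a; have c'0 : 0 < c' by rewrite mulr_gt0// expR_gt0.
rewrite -(holonomy_image hol) -lE//.
apply: (cover_le (ltW c'0) mE mP EP) => i G mG GE GP.
have [N hN] := PN i.
apply/lee_addgt0Pr => e e0.
have ec0 : 0 < e / c' by rewrite divr_gt0.
have [C [V [cC oV CG GV nuV]]] := @regular_measurable _ _ _ nu G mG _ ec0.
have mV : measurable (V : set (borel X)) by exact: measurable_open.
have nuVG : (c'%:E * nu V <= c'%:E * nu G + e%:E)%E.
  have /ltW VG : (nu (V `\` G : set (borel X)) < (e / c')%:E)%E.
    apply: le_lt_trans nuV; apply: le_measure; rewrite ?inE; [exact: measurableD| |].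
      by apply: measurableD => //; exact: measurable_closed.
    exact: setDS.
  have -> : e = c' * (e / c') by rewrite mulrC divfK// gt_eqF.
  rewrite [X in (_ <= _ + X)%E]EFinM -muleDr//; last by rewrite fin_num_adde_defl.
  rewrite lee_pmul2l//; apply: le_trans (leeD2l _ VG).
  have VE : V = G `|` (V `\` G) by rewrite setUC setDKU.
  rewrite [X in (nu X <= _)%E]VE; apply: measureU2 => //; exact: measurableD.
apply: le_trans nuVG.
(* The points of [G] whose whole [q]-cylinder lies in [V]. They exhaust [G], so it suffices to bound
   [l (H q)] for [q >= N]. *)
pose H q : set (borel X) := G `&` inner q V.
have mH q : measurable (H q).
  by apply: measurableI => //; apply: measurable_window; exact: window_inner.
have UH : \bigcup_q H q = G.
  by rewrite -setI_bigcupr bigcup_inner// setIidl.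
have cvgH : l (H q) @[q --> \oo] --> l G.
  rewrite -UH; apply: nondecreasing_cvg_mu => //; first by rewrite UH.
  by move=> p q pq; apply/subsetPset; apply: setIS; exact: innerW.
apply: (cvge_to_le cvgH); exists N => // q /= Nq.
pose key (x : borel X) : {ffun 'I_(q + q).+1 -> A} :=
  [ffun i : 'I_(q + q).+1 => (seq_of x (i%:Z - q%:Z) : A)].
have keyP x y : agree q (seq_of x) (seq_of y) -> key x = key y.
  by move=> xy; apply/ffunP => t; rewrite !ffunE; apply: xy; have := ltn_ord t; lia.
have Pkey x y : key x = key y -> agree q (seq_of x) (seq_of y).
  move=> /ffunP kE m mq; have iq : (`|(m + q%:Z)%R| < (q + q).+1)%N by lia.
  by have := kE (Ordinal iq); rewrite !ffunE /= (_ : _ - _ = m)//; lia.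
have mkey k : measurable (key @^-1` [set k]).
  by apply: (@measurable_window _ _ q) => x y xy /= <-; exact/esym/keyP.
rewrite (measure_partition l mkey (mH q)) (measure_partition nu mkey mV).
rewrite ge0_sume_distrr//; apply: lee_sum => k _.
have [->|/set0P[x [[Gx xV] kx]]] := eqVneq (H q `&` key @^-1` [set k]) set0.
  by rewrite measure0 mule_ge0// lee_fin ltW.
set S := H q `&` key @^-1` [set k].
have mS : measurable S by exact: measurableI.
have SE : S `<=` E by move=> y [[Gy _] _]; exact: GE.
have [_ mpS _ _] := holonomy_restr hol mS SE.
have mcyl (y : X) : measurable (cyl q y : set (borel X)).
  by apply: measurable_window; exact: window_cyl.
rewrite lE//; apply: (@le_trans _ _ (nu (cyl q (psi x)))).
  (* Within [[-N, N]] the images share a fixed block; beyond it [psi] changes nothing and the points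
     agree up to [q]. *)
  apply: le_measure; rewrite ?inE// => _ [y [[Gy _] ky] <-] m mq.
  have [xN xy pxy] := hN _ _ (GP _ Gx) (GP _ Gy).
  have [yN _ _] := hN _ _ (GP _ Gy) (GP _ Gx).
  have [mN|Nm] := leqP `|m| N; first exact: pxy.
  rewrite -xN// -yN//; apply: Pkey mq; by rewrite kx ky.
have [xN _ _] := hN _ _ (GP _ Gx) (GP _ Gx).
apply: le_trans (hc q x (psi x) _) _.
  by move=> m qm; apply: xN; exact: leq_ltn_trans qm.
apply: (@le_trans _ _ (c'%:E * nu (cyl q x))%E).
  apply: lee_wpmul2r => //; rewrite lee_fin ler_pM2l// ler_expR.
  by apply: le_a; exact: GE.
rewrite lee_pmul2l//; apply: le_measure; rewrite ?inE//; first exact: measurableI.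
by move=> y xy; split; [exact: xV|rewrite /= -kx; exact/esym/keyP].
Qed.

Definition null_preserving : Prop :=
  forall E F psi, holonomy E F psi -> nu E = 0%E -> nu F = 0%E.

(** The saturation is a countable union of sets [T i]: points with word [s'] that fall into [E] once
    [s] is written instead. Writing [s] is a holonomy from [T i] onto a null subset of [E], and its
    inverse shows that [T i] is null. *)
Lemma null_preserving_nonsingular : null_preserving -> nonsingular nu.
Proof.
move=> null E mE E0.
(* If no point has the word [s], this is the default point; the set [T i] still lies in the
   saturation. *)
pose u N (s : seq A) : X := xget point [set z | word N z = s].
pose T i : set (borel X) := if (unpickle i : option (nat * (seq A * seq A)%type)) is
  Some (N, (s, s')) then [set y | word N y = s'] `&`
    ([set y | shift_set X (patch_seq N (seq_of (u N s)) (seq_of y))] `&`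
     swap N (u N s) @^-1` E) else set0.
have mT i : measurable (T i).
  rewrite /T; case: unpickle => [[N [s s']]|]; last exact: measurable0.
  apply: measurableI.
    by apply: (@measurable_window _ _ N) => x y /wordP xy /= <-.
  apply: measurableI; first exact: measurable_patch.
  by have := @measurable_window_swap _ X N (u N s) measurableT _ mE; rewrite setTI.
have satE : saturation E = \bigcup_i T i.
  apply/seteqP; split=> y.
    move=> [x Ex /gibbs_relP[N xy]].
    exists (pickle (N, (word N x, word N y))) => //; rewrite /T pickleK.
    have /wordP ux : word N (u N (word N x)) = word N x.
      by rewrite /u; case: xgetP => [z _ //|/(_ x)]; case.
    have pE : patch_seq N (seq_of (u N (word N x))) (seq_of y) = seq_of x.
      apply/funext => m; rewrite /patch_seq; case: leqP => mN; first exact: ux.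
      by rewrite xy.
    have pX : shift_set X (patch_seq N (seq_of (u N (word N x))) (seq_of y)).
      by rewrite pE; exact: mem_seq_of.
    split=> //; split=> //=; rewrite (_ : swap _ _ _ = x)//.
    by apply: seq_of_inj; rewrite seq_swap.
  move=> [i _]; rewrite /T; case: unpickle => [[N [s s']]|//] [_ [_ Ey]].
  exists (swap N (u N s) y) => //; apply: gibbs_rel_sym; apply/gibbs_relP.
  by exists N; exact: swap_off.
have T0 i : nu (T i) = 0%E.
  have := mT i; rewrite /T; case: unpickle => [[N [s s']]|]; last by rewrite measure0.
  set T' := _ `&` _ => mT'.
  have [->|/set0P[v [vs' _]]] := eqVneq T' set0; first by rewrite measure0.
  have T'v y : T' y -> agree N (seq_of v) (seq_of y).
    by move=> [ys' _]; apply/wordP; rewrite vs' ys'.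
  have T'u y : T' y -> shift_set X (patch_seq N (seq_of (u N s)) (seq_of y)).
    by move=> [_ []].
  have hol := swap_holonomy mT' T'v T'u.
  have [psi [holi _ _]] := holonomy_inv hol.
  apply: null holi _; rewrite -(holonomy_image hol).
  have [_ mF _ _] := hol; rewrite -(holonomy_image hol) in mF.
  by apply: (subset_measure0 mF mE _ E0) => _ [y [_ [_ Ey]] <-].
rewrite satE; apply/eqP; rewrite -measure_le0.
apply: le_trans (measure_sigma_subadditive nu mT _ (@subset_refl _ _)) _.
  exact: bigcupT_measurable.
by rewrite eseries0 => [|i _ _]; [exact: lexx|exact: T0].
Qed.

End HolonomyMeasure.

Section NullPreserving.
Variables (R : realType) (A : finType) (X : shiftSpace A).
Variables (f : X -> R) (w : nat -> R) (W : R).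
Hypothesis fw : modulus f w W.
Variable (nu : probability (borel X) R).

(** The cocycle may be unbounded on [E], but on each piece it stays within [C0] of its value at one
    point. *)
Lemma holonomy_bound_null c : 0 < c -> holonomy_bound nu (potential_cocycle f) c ->
  null_preserving nu.
Proof.
move=> c0 hc E F psi hol E0.
have [mE mF _ _] := hol.
have [l lfin lE] := holonomy_measure nu hol.
have [P [mP EP PN]] := holonomy_pieces hol.
rewrite -(holonomy_image hol) -lE//.
apply/eqP; rewrite -measure_le0 -[leRHS](mul0e (nu E)).
apply: (cover_le (lexx 0) mE mP EP) => i G mG GE GP.
have G0 : nu G = 0%E by exact: subset_measure0 GE E0.
have [->|/set0P[x Gx]] := eqVneq G set0; first by rewrite !measure0 mule0.
have [N hN] := PN i.
pose C0 := ((w 0%N *+ 0 + W) *+ 4 + w 0%N *+ 0) *+ 2.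
rewrite mul0e lE//.
apply: le_trans (hc _ _ _ (potential_cocycle f x (psi x) + C0)
  (holonomy_restr hol mG GE) _) _; last by rewrite G0 mule0.
move=> y Gy.
have [xN xy pxy] := hN _ _ (GP _ Gx) (GP _ Gy).
have [yN yx pyx] := hN _ _ (GP _ Gy) (GP _ Gx).
have := @cocycle_compare _ _ _ _ _ _ fw 0 N 0 y (psi y) x (psi x) isT.
rewrite addn0 => /(_ yN xN pyx) h.
have : `|potential_cocycle f y (psi y) - potential_cocycle f x (psi x)| <= C0.
  by apply: h => m; rewrite addr0 => mN; rewrite yx.
by rewrite ler_norml => /andP[_]; rewrite lerBlDl.
Qed.

End NullPreserving.

(** * Shift-invariant sets are saturated *)

Section Tail.
Variables (R : realType) (A : finType) (X : shiftSpace A).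
Variable (nu : probability (borel X) R).
Hypothesis nu_inv : shift_invariant nu.

(* Shifting clopen approximations of [P] far away makes them insensitive to
   finitely many coordinates, without changing [P] up to a null set. *)
Lemma tail_approx (P : set (borel X)) : measurable P ->
  (shift_map 1 : borel X -> borel X) @^-1` P `<=` P ->
  exists P' : set (borel X), [/\ measurable P',
    forall x y : X, gibbs_rel x y -> P' x -> P' y,
    nu (P `\` P') = 0%E & nu (P' `\` P) = 0%E].
Proof.
move=> mP sP.
pose s (m : nat) : borel X -> borel X := @shift_map A X m%:Z.
have mS m (S : set (borel X)) : measurable S -> measurable (s m @^-1` S).
  exact: measurable_shift_preimage.
have inv m (S : set (borel X)) : measurable S -> nu (s m @^-1` S) = nu S.
  exact: shift_invariant_int.
have sPm m : s m @^-1` P `<=` P.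
  elim: m => [|m IHm] x; first by rewrite /= /s shift_map0.
  move=> Px; apply: IHm; apply: sP; rewrite /= /s shift_mapD.
  by rewrite (_ : 1 + m%:Z = m.+1%:Z)//; lia.
(* The preimage is contained in [P] and has the same finite measure. *)
have Pm0 m : nu (P `\` s m @^-1` P) = 0%E.
  rewrite measureD//; [|exact: mS|by rewrite (le_lt_trans (probability_le1 _ _))// ltry].
  rewrite (setIidr (sPm m)); transitivity (nu P - nu P)%E.
    by congr (_ - _)%E; exact: inv.
  by rewrite subee// fin_num_measure.
pose e k : R := (1 / (2 ^ k.+1)%:R).
have e0 k : 0 < e k by rewrite divr_gt0// ltr0n expn_gt0.
have /choice[n /choice[S hS]] k := @window_approx _ _ _ nu P (e k) mP (e0 k).
have wS k : window_set (n k) (S k) by case: (hS k).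
have mSk k : measurable (S k : set (borel X)) by exact: measurable_window (wS k).
(* As [S k] depends on the coordinates in [[-n k, n k]], this shift makes [D k] depend only on
   coordinates beyond [k]. *)
pose D k : set (borel X) := s (n k + k.+1)%N @^-1` S k.
have mD k : measurable (D k) by exact: mS.
have PS k : (nu (P `\` S k) <= (e k)%:E)%E.
  by have [_ /ltW] := hS k; apply: le_trans; rewrite leeDl.
have SP k : (nu (S k `\` P) <= (e k)%:E)%E.
  by have [_ /ltW] := hS k; apply: le_trans; rewrite leeDr.
have PD k : (nu (P `\` D k) <= (e k)%:E)%E.
  set m := (n k + k.+1)%N.
  apply: le_trans (PS k).
  rewrite -(inv m _ (measurableD mP (mSk k))).
  apply: (@le_trans _ _ (nu ((P `\` s m @^-1` P) `|` s m @^-1` (P `\` S k)))).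
    apply: le_measure; rewrite ?inE; first exact: measurableD.
      by apply: measurableU; [apply: measurableD => //; exact: mS|apply: mS; exact: measurableD].
    move=> x [Px nDx]; have [sPx|nsPx] := pselect (P (s m x)); first by right.
    by left.
  apply: le_trans (measureU2 _ _ _) _.
  - by apply: measurableD => //; exact: mS.
  - by apply: mS; exact: measurableD.
  - rewrite -[leRHS]add0e; apply: leeD; last exact: lexx.
    by rewrite measure_le0; apply/eqP; exact: Pm0.
have DP k : (nu (D k `\` P) <= (e k)%:E)%E.
  set m := (n k + k.+1)%N.
  apply: le_trans (SP k).
  rewrite -(inv m _ (measurableD (mSk k) mP)).
  apply: le_measure; rewrite ?inE; first exact: measurableD.
    by apply: mS; exact: measurableD.
  by move=> x [Dx nPx]; split=> // /sPm.
have sum_e (u : (\bar R)^nat) : (forall k, 0 <= u k)%E -> (forall k, u k <= (e k)%:E)%E ->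
    (\sum_(0 <= k <oo) u k < +oo)%E.
  move=> u0 ue; apply: (@le_lt_trans _ _ (1 : R)%:E); last exact: ltry.
  apply: le_trans (@epsilon_trick0 R 1 xpredT _); last exact: ler01.
  by apply: lee_nneseries => [i _ _|i _]; [exact: u0|exact: ue].
(* Membership in the limit superior ignores finitely many coordinates, and by Borel-Cantelli it
   differs from [P] by a null set, since the errors [e k] are summable. *)
exists (lim_sup_set D); split.
- apply: bigcapT_measurable => k; exact: bigcup_measurable.
- move=> x y /gibbs_relP[N xy] Dx k _.
  have [j /= kNj Dj] := Dx (maxn k N) I.
  move: kNj; rewrite geq_max => /andP[kj Nj].
  exists j => //; apply: wS Dj => i ij; rewrite /s !seq_shift xy//; lia.
- apply: (subset_measure0 _ _ _ (lim_sup_set_cvg0 (F := fun k => P `\` D k) _ _)).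
  + apply: measurableD => //; apply: bigcapT_measurable => k; exact: bigcup_measurable.
  + by apply: bigcapT_measurable => k; apply: bigcup_measurable => j _; exact: measurableD.
  + move=> x [Px nDx] k _; apply: contrapT => h; apply: nDx => j _.
    apply: contrapT => h'; apply: h; exists (maxn k j); first by rewrite /= leq_maxl.
    by split=> // Dx; apply: h'; exists (maxn k j) => //=; rewrite leq_maxr.
  + by move=> k; exact: measurableD.
  + by apply: sum_e.
- apply: (subset_measure0 _ _ _ (lim_sup_set_cvg0 (F := fun k => D k `\` P) _ _)).
  + apply: measurableD => //; apply: bigcapT_measurable => k; exact: bigcup_measurable.
  + by apply: bigcapT_measurable => k; apply: bigcup_measurable => j _; exact: measurableD.
  + by move=> x [Dx nPx] k _; have [j kj Dj] := Dx k I; exists j.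
  + by move=> k; exact: measurableD.
  + by apply: sum_e.
Qed.

End Tail.

(** * Holonomy bounds restricted to a set of starting points *)

Section Bootstrap.
Variables (R : realType) (A : finType) (X : shiftSpace A).
Variables (f : X -> R) (w : nat -> R) (W : R).
Hypothesis fw : modulus f w W.
Variable (nu : probability (borel X) R).
Hypothesis nu_inv : shift_invariant nu.
Let phi := potential_cocycle f.

Lemma holonomy_shift (E F : set (borel X)) psi : holonomy E F psi ->
  holonomy ((shift_map (- 1) : borel X -> borel X) @^-1` E)
           ((shift_map (- 1) : borel X -> borel X) @^-1` F)
           (fun x => shift_map 1 (psi (shift_map (- 1) x))).
Proof.
move=> [mE mF [psi' [EF FE K K' [m m']]] g].
have sK : cancel (shift_map (- 1)) (shift_map 1 : X -> X).
  by move=> x; rewrite shift_mapD subrr shift_map0.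
have sK' : cancel (shift_map 1) (shift_map (- 1) : X -> X).
  by move=> x; rewrite shift_mapD addNr shift_map0.
have meas (G : set (borel X)) (q : borel X -> borel X) : measurable G -> measurable_fun G q ->
    measurable_fun ((shift_map (- 1) : borel X -> borel X) @^-1` G)
      (fun x : borel X => shift_map 1 (q (shift_map (- 1) x)) : borel X).
  move=> mG mq _ S mS.
  have := measurable_shift_preimage (- 1) (mq mG _ (measurable_shift_preimage 1 mS)).
  by rewrite preimage_setI.
split; [exact: measurable_shift_preimage|exact: measurable_shift_preimage| |].
  exists (fun x => shift_map 1 (psi' (shift_map (- 1) x))); split.
  - by move=> x Ex; rewrite /= sK'; exact: EF.
  - by move=> x Ex; rewrite /= sK'; exact: FE.
  - by move=> x; rewrite inE => Ex; rewrite sK' K ?inE// sK.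
  - by move=> x; rewrite inE => Ex; rewrite sK' K' ?inE// sK.
  - by split; exact: meas.
move=> x Ex; rewrite -{1}[x]sK; apply: gibbs_rel_shift; exact: g.
Qed.

(** Only the domain is confined to [H], not the image, so the property passes to shifts and
    countable unions of [H]. *)
Definition bounded_on (c : R) (H : set (borel X)) : Prop :=
  forall E F psi a, holonomy E F psi -> E `<=` H ->
    (forall x, E x -> phi x (psi x) <= a) ->
    (nu F <= (c * expR a)%:E * nu E)%E.

(** Conjugation by the shift preserves both the measure and the cocycle. *)
Lemma bounded_on_shift c H : bounded_on c H ->
  bounded_on c ((shift_map 1 : borel X -> borel X) @^-1` H).
Proof.
move=> hH E F psi a hol EH le_a; have [mE mF _ g] := hol.
rewrite -(shift_invariant_int (- 1) nu_inv mF) -(shift_invariant_int (- 1) nu_inv mE).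
have sK (x : X) : shift_map 1 (shift_map (- 1) x) = x.
  by rewrite shift_mapD subrr shift_map0.
apply: hH (holonomy_shift hol) _ _.
  by move=> x /EH; rewrite /= sK.
move=> x Ex; have := le_a _ Ex.
rewrite /phi -(cocycle_shift fw); last exact: g.
by rewrite sK.
Qed.

Lemma bounded_on_bigcup c (H : (set (borel X))^nat) : 0 <= c ->
  (forall i, measurable (H i)) -> (forall i, bounded_on c (H i)) ->
  bounded_on c (\bigcup_i H i).
Proof.
move=> c0 mH hH E F psi a hol EH le_a; have [mE _ _ _] := hol.
have [l _ lE] := holonomy_measure nu hol.
rewrite -(holonomy_image hol) -lE//.
apply: (cover_le _ mE mH EH) => [|i G mG GE GH]; first by rewrite mulr_ge0// expR_ge0.
rewrite lE//; apply: (hH i _ _ _ _ (holonomy_restr hol mG GE)) => // x /GE.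
exact: le_a.
Qed.

(** The part of a holonomy that starts outside [H] has a null domain, hence a null image. *)
Lemma bounded_on_null c H H' : null_preserving nu -> 0 <= c -> measurable H -> measurable H' ->
  nu (H' `\` H) = 0%E -> bounded_on c H -> bounded_on c H'.
Proof.
move=> null c0 mH mH' H0 hH E F psi a hol EH le_a; have [mE _ _ _] := hol.
have [l _ lE] := holonomy_measure nu hol.
rewrite -(holonomy_image hol) -lE//.
pose G i := if i is 0%N then H else ~` H.
apply: (@cover_le _ _ _ _ _ _ _ G) => //.
- by rewrite mulr_ge0// expR_ge0.
- by case=> //= _; exact: measurableC.
- by move=> x _; have [Hx|Hx] := pselect (H x); [exists 0%N|exists 1%N].
case=> [|i] K mK KE KH; rewrite lE//.
  by apply: (hH _ _ _ _ (holonomy_restr hol mK KE)) => // x /KE; exact: le_a.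
rewrite (null _ _ _ (holonomy_restr hol mK KE)).
  by rewrite mule_ge0// lee_fin mulr_ge0// expR_ge0.
apply: (subset_measure0 mK _ _ H0); first exact: measurableD.
by move=> x Kx; split; [exact/EH/KE|exact: KH].
Qed.

End Bootstrap.

(** * Improvement of the constant *)

Lemma ler_of_gt1 (R : realType) (x y : R) : 0 <= y ->
  (forall c, 1 < c -> x <= c * y) -> x <= y.
Proof.
move=> y0 h; apply/ler_addgt0Pr => e e0.
(* The denominator is [y + 1] because [y] may vanish. *)
apply: (le_trans (h (1 + e / (y + 1)) _)).
  by rewrite ltrDl divr_gt0// ltr_wpDl.
rewrite mulrDl mul1r lerD2l mulrAC -mulrA ler_piMr//; first exact: ltW.
by rewrite ler_pdivrMr ?mul1r ?lerDl// ltr_wpDl.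
Qed.

Section Improve.
Variables (R : realType) (A : finType) (X : shiftSpace A).
Variables (f : X -> R) (w : nat -> R) (W : R).
Hypothesis fw : modulus f w W.
Variable (nu : probability (borel X) R).
Hypothesis nu_inv : shift_invariant nu.
Let phi := potential_cocycle f.

(** A holonomy starting in [F] is preceded by [psi]. The composition obeys the bound with [c], and
    the factor [t] already gained by [psi] is divided out. *)
Lemma bounded_on_image c t a (E F : set (borel X)) psi :
  0 < c -> 0 < t -> holonomy_bound nu phi c -> holonomy E F psi ->
  (forall x, E x -> phi x (psi x) <= a) ->
  (forall G, measurable G -> G `<=` E ->
     ((t * expR a)%:E * nu G <= nu (psi @` G))%E) ->
  bounded_on f nu (c / t) F.
Proof.
move=> c0 t0 hc hol le_a ge_t K L chi b holK KF le_b.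
have [mK mL _ gchi] := holK.
have [psi' [holi _ psiK]] := holonomy_inv hol.
have hK := holonomy_restr holi mK KF.
pose G := psi' @` K.
have GE : G `<=` E.
  by move=> _ [y /KF Fy <-]; have [_ _ [_ [FE _ _ _ _]] _] := holi; exact: FE.
have GK : psi @` G = K.
  apply/seteqP; split=> y.
    by move=> [_ [z Kz <-] <-]; rewrite psiK//; exact: KF.
  by move=> Ky; exists (psi' y); [exists y|rewrite psiK//; exact: KF].
have [_ mG _ _] := hK.
have holG := holonomy_restr hol mG GE; rewrite GK in holG.
have := ge_t _ mG GE; rewrite GK => nuG.
have [_ _ _ gpsi] := holG.
have nuL : (nu L <= (c * expR (a + b))%:E * nu G)%E.
  apply: (hc _ _ _ _ (holonomy_comp holG holK)) => x Gx /=.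
  have Kpsi : K (psi x) by rewrite -GK; exists x.
  rewrite /phi (cocycle_trans fw (gpsi _ Gx) (gchi _ Kpsi)); apply: lerD.
    by apply: le_a; exact: GE.
  exact: le_b.
apply: le_trans nuL _.
have fine_nu (S : set (borel X)) : measurable S -> nu S = (fine (nu S))%:E.
  by move=> mS; rewrite fineK// fin_num_measure.
move: nuG; rewrite (fine_nu _ mG) (fine_nu _ mK) -!EFinM !lee_fin => nuG.
have -> : c * expR (a + b) * fine (nu G) =
    c / t * expR b * (t * expR a * fine (nu G)).
  by rewrite expRD; field; rewrite gt_eqF.
by apply: ler_wpM2l => //; rewrite mulr_ge0 ?expR_ge0// divr_ge0// ltW.
Qed.

Lemma holonomy_bound_improve c t : 0 < c -> 0 < t -> c < t ^+ 2 ->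
  holonomy_bound nu phi c -> holonomy_bound nu phi t.
Proof.
move=> c0 t0 ct hc E F psi a hol le_a; rewrite leNgt; apply/negP => contra.
have null := holonomy_bound_null fw c0 hc.
have [mE mF _ g] := hol.
have [l lfin lE] := holonomy_measure nu hol.
have nufin : fin_num_fun nu by move=> G mG; exact: fin_num_measure.
have ta0 : 0 < t * expR a by rewrite mulr_gt0// expR_gt0.
(* On [Q] the image measure is at least [t e^a nu], off [Q] at most that. *)
have [Q [mQ Qge Qle]] := Hahn_le (t * expR a) lfin nufin.
pose E1 := E `&` Q.
have mE1 : measurable E1 by exact: measurableI.
have E1E : E1 `<=` E by move=> x [].
pose H := psi @` E1.
have hol1 : holonomy E1 H psi := holonomy_restr hol mE1 E1E.
have [_ mH _ _] := hol1.
have le_a1 x : E1 x -> phi x (psi x) <= a by move=> /E1E; exact: le_a.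
have ge_t G : measurable G -> G `<=` E1 ->
    ((t * expR a)%:E * nu G <= nu (psi @` G))%E.
  move=> mG GE1; rewrite -lE//; last exact: subset_trans E1E.
  by apply: Qge => // x /GE1[].
(* Were [H] null, the bound with [t] on the rest of [E] would give it on all of [E]. *)
have H0 : (0 < nu H)%E.
  rewrite lt0e measure_ge0 andbT; apply/eqP => nuH0.
  have : (nu F <= (t * expR a)%:E * nu E)%E.
    rewrite -(holonomy_image hol) -lE//.
    have lEU : (l E <= l E1 + l (E `\` E1))%E.
      rewrite -[X in (l X <= _)%E](setDUK E1E); apply: measureU2 => //.
      exact: measurableD.
    have l1 : (l E1 <= 0)%E by rewrite lE// -nuH0.
    have l2 : (l (E `\` E1) <= (t * expR a)%:E * nu (E `\` E1))%E.
      apply: Qle; first exact: measurableD.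
      by move=> x [Ex nE1] Qx; exact: nE1.
    apply: le_trans lEU _; apply: le_trans (leeD l1 l2) _; rewrite add0e.
    rewrite lee_pmul2l//; apply: le_measure; rewrite ?inE//.
    exact: measurableD.
  by rewrite leNgt contra.
have ct0 : 0 <= c / t by rewrite divr_ge0// ltW.
have bH : bounded_on f nu (c / t) H := bounded_on_image c0 t0 hc hol1 le_a1 ge_t.
pose S n : set (borel X) := (@shift_map A X n%:Z : borel X -> borel X) @^-1` H.
have mS n : measurable (S n) by exact: measurable_shift_preimage.
have bS n : bounded_on f nu (c / t) (S n).
  elim: n => [|n IHn].
    by rewrite (_ : S 0%N = H)//; apply/seteqP; split=> x; rewrite /S /= shift_map0.
  rewrite (_ : S n.+1 = (shift_map 1 : borel X -> borel X) @^-1` S n).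
    exact: (bounded_on_shift fw nu_inv).
  by apply/seteqP; split=> x; rewrite /S /= shift_mapD intS addrC.
pose P := \bigcup_n S n.
have mP : measurable P by exact: bigcupT_measurable.
have bP : bounded_on f nu (c / t) P by exact: bounded_on_bigcup.
have sP : (shift_map 1 : borel X -> borel X) @^-1` P `<=` P.
  move=> x [n _ Snx]; exists n.+1 => //; move: Snx.
  by rewrite /S /= shift_mapD intS addrC.
have [P' [mP' tail PP' P'P]] := tail_approx nu_inv mP sP.
have bP' : bounded_on f nu (c / t) P' by exact: bounded_on_null P'P bP.
have mG : measurable (E1 `&` P') by exact: measurableI.
have GE1 : E1 `&` P' `<=` E1 by move=> x [].
(* As [P'] is saturated, [psi] respects it. So the bound with [c / t] applies to [psi] on [E1]
   intersected with [P'], whose image is almost all of [H] because [H] lies in [P]. *)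
have imG : psi @` (E1 `&` P') = H `&` P'.
  apply/seteqP; split=> y.
    move=> [x [Ex P'x] <-]; split; first by exists x.
    by apply: tail P'x; exact/g/E1E.
  move=> [[x Ex <-] P'x]; exists x => //; split=> //.
  by apply: tail P'x; exact/gibbs_rel_sym/g/E1E.
have nuHP : nu (H `&` P') = nu H.
  rewrite [RHS](_ : _ = nu (H `&` P' `|` H `\` P'))//; last by rewrite setUIDK.
  have HP0 : nu (H `\` P') = 0%E.
    apply: (subset_measure0 _ _ _ PP'); [exact: measurableD|exact: measurableD|].
    by move=> x [Hx nP]; split=> //; exists 0%N => //; rewrite /S /= shift_map0.
  rewrite measureU0//; [exact: measurableI|exact: measurableD].
have holG := holonomy_restr hol1 mG GE1; rewrite imG in holG.
have up : (nu H <= (c / t * expR a)%:E * nu (E1 `&` P'))%E.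
  rewrite -nuHP; apply: (bP' _ _ _ _ holG) => [x [] //|x /GE1]; exact: le_a1.
have := ge_t _ mG GE1; rewrite imG nuHP => low.
have fine_nu (G : set (borel X)) : measurable G -> nu G = (fine (nu G))%:E.
  by move=> mG'; rewrite fineK// fin_num_measure.
move: up low H0; rewrite (fine_nu _ mH) (fine_nu _ mG) -!EFinM !lee_fin lte_fin.
set h := fine (nu H); set e := fine _; move=> up low h0.
have : h <= c / t ^+ 2 * h.
  apply: le_trans up _.
  have -> : c / t * expR a * e = c / t ^+ 2 * (t * expR a * e).
    by field; rewrite gt_eqF.
  by apply: ler_wpM2l => //; rewrite divr_ge0 ?exprn_ge0// ltW.
rewrite ler_pMl// leNgt => /negP; apply.
by rewrite ltr_pdivrMr ?mul1r// exprn_gt0.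
Qed.

Lemma holonomy_bound_le c c' : c <= c' -> holonomy_bound nu phi c -> holonomy_bound nu phi c'.
Proof.
move=> cc' hc E F psi a hol le_a; apply: le_trans (hc _ _ _ _ hol le_a) _.
by apply: lee_wpmul2r => //; rewrite lee_fin ler_wpM2r// expR_ge0.
Qed.

(** Let [m] be the infimum of the admissible constants that are at least 1. If [m > 1], then
    [t = (m + 1) / 2] satisfies [t < m < t^2]; a constant between [m] and [t^2] is admissible, and
    improving it yields [t], against the choice of [m]. *)
Lemma holonomy_bound1 c : holonomy_bound nu phi c -> holonomy_bound nu phi 1.
Proof.
move=> hc0; pose S := [set c | 1 <= c /\ holonomy_bound nu phi c].
have S1 : S (Num.max 1 c).
  by split; [rewrite le_max lexx|apply: holonomy_bound_le hc0; rewrite le_max lexx orbT].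
have hS : has_inf S by split; [exists (Num.max 1 c)|exists 1 => x []].
pose m := inf S.
have m1 : 1 <= m by apply: lb_le_inf => [|x []//]; exists (Num.max 1 c).
have Sgt t : m < t -> holonomy_bound nu phi t.
  move=> mt; have t0 : 0 < t - m by rewrite subr_gt0.
  have [d [_ hd]] := inf_adherent t0 hS.
  by rewrite addrC subrK => dt; exact: holonomy_bound_le (ltW dt) hd.
have mE : m = 1.
  apply/eqP; rewrite eq_le m1 andbT leNgt; apply/negP => m_gt1.
  pose t := (m + 1) / 2; pose d := (m + t ^+ 2) / 2.
  have t1 : 1 < t by rewrite /t; lra.
  have mt : m < t ^+ 2 by rewrite /t; nra.
  have hd : holonomy_bound nu phi d by apply: Sgt; rewrite /d; lra.
  have ht : holonomy_bound nu phi t.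
    by apply: holonomy_bound_improve hd; rewrite /d; lra.
  have : m <= t by apply: ge_inf; [exists 1 => x []|split=> //; exact: ltW].
  rewrite /t; lra.
move=> E F psi a hol le_a; have [mE' mF _ _] := hol.
have fine_nu (G : set (borel X)) : measurable G -> nu G = (fine (nu G))%:E.
  by move=> mG; rewrite fineK// fin_num_measure.
rewrite (fine_nu _ mF) (fine_nu _ mE') -EFinM lee_fin mul1r.
set u := fine _; set v := fine _.
apply: ler_of_gt1; first by rewrite mulr_ge0 ?expR_ge0// fine_ge0.
move=> d d1; have md : m < d by rewrite mE.
have := Sgt d md E F psi a hol le_a.
by rewrite (fine_nu _ mF) (fine_nu _ mE') -EFinM lee_fin -mulrA.
Qed.

End Improve.

(** * The Radon-Nikodym derivative *)

Section GibbsOfBound.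
Variables (R : realType) (A : finType) (X : shiftSpace A).
Variables (f : X -> R) (w : nat -> R) (W : R).
Hypothesis fw : modulus f w W.
Hypothesis fc : continuous f.
Variable (nu : probability (borel X) R).
Let phi := potential_cocycle f.

(** The cocycle is a pointwise limit of finite sums of measurable functions, as [x] and [psi x] are
    Gibbs related. *)
Lemma measurable_cocycle (E F : set (borel X)) psi : holonomy E F psi ->
  measurable_fun E (fun x => phi x (psi x)).
Proof.
move=> [mE _ [psi' [_ _ _ _ [mpsi _]]] g].
have mterm n : measurable_fun E
    (fun x : borel X => f (shift_map n (psi x)) - f (shift_map n x)).
  have mf : measurable_fun setT (f : borel X -> R) := measurable_continuous fc.
  have ms := @measurable_shift _ X n.
  apply: measurable_funB.
    exact: (measurableT_comp mf (measurableT_comp ms mpsi)).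
  exact: (measurableT_comp mf (measurable_funS measurableT (@subsetT _ E) ms)).
apply: measurable_funD.
  apply: (measurable_fun_cvg (h := fun n (x : borel X) => series (fun k : nat =>
      f (shift_map k%:Z (psi x)) - f (shift_map k%:Z x)) n)).
    by move=> n; apply: measurable_sum => k; exact: mterm.
  by move=> x Ex; exact: (cvg_fpos fw (g _ Ex)).
apply: (measurable_fun_cvg (h := fun n (x : borel X) => series (fun k : nat =>
    f (shift_map (- k.+1%:Z) (psi x)) - f (shift_map (- k.+1%:Z) x)) n)).
  by move=> n; apply: measurable_sum => k; exact: mterm.
by move=> x Ex; exact: (cvg_fneg fw (g _ Ex)).
Qed.

(* The cocycle is nearly constant on each slice, where both inequalities
   follow from [holonomy_bound] for the holonomy and for its inverse. *)
Lemma holonomy_bound_slices (E F : set (borel X)) psi (eta : R) :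
  holonomy_bound nu phi 1 -> holonomy E F psi -> 0 < eta ->
  (nu F <= (expR eta)%:E * \int[nu]_(x in E) (expR (phi x (psi x)))%:E)%E /\
  (\int[nu]_(x in E) (expR (phi x (psi x)))%:E <= (expR eta)%:E * nu F)%E.
Proof.
move=> h1 hol eta0; have [mE mF _ grel] := hol.
have [l _ lE] := holonomy_measure nu hol.
have mphi := measurable_cocycle hol.
pose g (x : borel X) : \bar R := (expR (phi x (psi x)))%:E.
have mg : measurable_fun E g.
  by apply/measurable_EFinP; apply: measurableT_comp mphi.
have g0 x : (0 <= g x)%E by rewrite lee_fin expR_ge0.
(* On a slice the cocycle varies by less than [eta]. The slices are indexed by integers through
   their codes; other numbers give the empty set. *)
pose S (k : nat) : set (borel X) := if pickle_inv k : option int is Some i then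
  E `&` [set x | i%:~R * eta <= phi x (psi x) < (i + 1)%:~R * eta] else set0.
have mS k : measurable (S k).
  rewrite /S; case: pickle_inv => [i|]; last exact: measurable0.
  have -> : [set x | i%:~R * eta <= phi x (psi x) < (i + 1)%:~R * eta] =
      (fun x => phi x (psi x)) @^-1` `[i%:~R * eta, (i + 1)%:~R * eta[%classic.
    by apply/seteqP; split=> x /=; rewrite in_itv.
  by apply: mphi => //; exact: measurable_itv.
have US : \bigcup_k S k = E.
  apply/seteqP; split=> x.
    by move=> [k _]; rewrite /S; case: pickle_inv => // i [].
  move=> Ex; have : exists i : int, i%:~R * eta <= phi x (psi x) < (i + 1)%:~R * eta.
    exists (Num.floor (phi x (psi x) / eta)).
    by rewrite -ler_pdivlMr// -ltr_pdivrMr// ge_floor floorD1_gt.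
  by move=> [i xi]; exists (pickle i); [exact: I|rewrite /S pickleK_inv; split].
have tS : trivIset setT S.
  apply/trivIsetP => k k' _ _ kk'; apply/seteqP; split=> // x.
  rewrite /S; case E1: (pickle_inv k) => [i|] []; case E2: (pickle_inv k') => [i'|] //.
  move=> [_ /= /andP[a1 a2]] [_ /= /andP[b1 b2]].
  have := le_lt_trans a1 b2; have := le_lt_trans b1 a2.
  rewrite !ltr_pM2r// !ltr_int !ltzD1 => i1 i2.
  have ii' : i = i' by apply/eqP; rewrite eq_le i1 i2.
  move/eqP: kk'; apply.
  have := @pickle_invK int k; have := @pickle_invK int k'.
  by rewrite E1 E2 /= => <- <-; rewrite ii'.
have mUS : measurable (\bigcup_k S k) by rewrite US.
have SE k : S k `<=` E by rewrite -US => x Sx; exists k.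
have lsum : nu F = (\sum_(0 <= k <oo) l (S k))%E.
  by rewrite -measure_semi_bigcup// US lE// (holonomy_image hol).
have isum : (\int[nu]_(x in E) g x = \sum_(0 <= k <oo) \int[nu]_(x in S k) g x)%E.
  by rewrite -US ge0_integral_bigcup// US.
have l0 k : (0 <= l (S k))%E by exact: measure_ge0.
have i0 k : (0 <= \int[nu]_(x in S k) g x)%E by exact: integral_ge0.
have slice k : (l (S k) <= (expR eta)%:E * \int[nu]_(x in S k) g x)%E /\
    (\int[nu]_(x in S k) g x <= (expR eta)%:E * l (S k))%E.
  have holS := holonomy_restr hol (mS k) (@SE k).
  rewrite lE//; have := holS; have := mS k; have := @SE k.
  have mgS : measurable_fun (S k) g by exact: measurable_funS mg.
  have [S0|[i Si]] : S k = set0 \/ exists i : int, forall x, S k x ->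
      i%:~R * eta <= phi x (psi x) < (i + 1)%:~R * eta.
    rewrite /S; case: pickle_inv => [i|]; last by left.
    by right; exists i => x [].
    by rewrite S0 image_set0 measure0 integral_set0 mule0.
  move=> SkE mSk hS.
  have [psi' [holi _ psiK]] := holonomy_inv hS.
  have up : (nu (psi @` S k) <= (expR ((i + 1)%:~R * eta))%:E * nu (S k))%E.
    by rewrite -[expR _]mul1r; apply: (h1 _ _ _ _ hS) => x /Si /andP[_ /ltW].
  (* The cocycle of the inverse is at most [- i eta] on the image of the slice. *)
  have low : (nu (S k) <= (expR (- (i%:~R * eta)))%:E * nu (psi @` S k))%E.
    rewrite -[expR _]mul1r; apply: (h1 _ _ _ _ holi) => y Fy.
    have [_ _ [_ [FS _ _ _ _]] gr] := holi.
    have Sy := FS _ Fy.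
    rewrite /phi (cocycle_sym fw); last by apply: gibbs_rel_sym; exact: gr.
    by rewrite lerN2 -{2}[y]psiK//; have /andP[] := Si _ Sy.
  have ilow : ((expR (i%:~R * eta))%:E * nu (S k) <= \int[nu]_(x in S k) g x)%E.
    rewrite -integral_cst//; apply: ge0_le_integral => //.
    - by move=> x _; rewrite lee_fin expR_ge0.
    - by move=> x Sx; rewrite lee_fin ler_expR; have /andP[] := Si _ Sx.
  have iup : (\int[nu]_(x in S k) g x <= (expR ((i + 1)%:~R * eta))%:E * nu (S k))%E.
    rewrite -integral_cst//; apply: ge0_le_integral => //.
    by move=> x Sx; rewrite lee_fin ler_expR; have /andP[_ /ltW] := Si _ Sx.
  have expE : expR ((i + 1)%:~R * eta) = expR eta * expR (i%:~R * eta).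
    by rewrite -expRD intrD mulrDl mul1r addrC.
  split.
    apply: le_trans up _; rewrite expE EFinM -muleA.
    by apply: lee_wpmul2l => //; rewrite lee_fin expR_ge0.
  apply: le_trans iup _; rewrite expE EFinM -muleA.
  apply: lee_wpmul2l; first by rewrite lee_fin expR_ge0.
  apply: le_trans (lee_wpmul2l _ low) _; first by rewrite lee_fin expR_ge0.
  by rewrite muleA -EFinM -expRD subrr expR0 mul1e.
rewrite lsum -/g isum; split.
  rewrite -nneseriesZl//; apply: lee_nneseries => [k _ _|k _] //.
  by have [] := slice k.
rewrite -nneseriesZl//; apply: lee_nneseries => [k _ _|k _] //.
by have [] := slice k.
Qed.

(** The exponential of the cocycle is itself taken as the density; the slice estimates for all
    [eta > 0] force equality of the two measures. *)
Lemma gibbs_of_holonomy_bound : holonomy_bound nu phi 1 -> gibbs_measure phi nu.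
Proof.
move=> h1; split.
  exact/null_preserving_nonsingular/(holonomy_bound_null fw ltr01).
move=> E F psi hol; exists (fun x => (expR (phi x (psi x)))%:E); last first.
  exact: aeW.
split.
- by apply/measurable_EFinP; apply: measurableT_comp (measurable_cocycle hol).
- by move=> x _; rewrite lee_fin expR_ge0.
move=> G mG GE; have holG := holonomy_restr hol mG GE.
have [_ mF _ _] := holG.
set I := (\int[nu]_(x in G) _)%E.
have I0 : (0 <= I)%E by apply: integral_ge0 => x _; rewrite lee_fin expR_ge0.
have nuE : nu (psi @` G) = (fine (nu (psi @` G)))%:E by rewrite fineK// fin_num_measure.
have Ifin : I \is a fin_num.
  rewrite ge0_fin_numE//; have [_ h] := holonomy_bound_slices h1 holG ltr01.
  by apply: le_lt_trans h _; rewrite nuE -EFinM ltry.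
have le_of (x y : R) : 0 <= y -> (forall e, 0 < e -> x <= expR e * y) -> x <= y.
  move=> y0 h; apply: ler_of_gt1 => // c c1.
  (* With [e = ln c] the factor [expR e] is an arbitrary [c > 1]. *)
  by have := h (ln c) (ln_gt0 c1); rewrite lnK// posrE (lt_trans ltr01).
rewrite nuE -(fineK Ifin); congr (_%:E); apply/eqP; rewrite eq_le; apply/andP; split.
  apply: le_of; first exact: fine_ge0.
  move=> e e0; have [h _] := holonomy_bound_slices h1 holG e0.
  by rewrite -lee_fin EFinM -nuE fineK.
apply: le_of; first by rewrite fine_ge0.
move=> e e0; have [_ h] := holonomy_bound_slices h1 holG e0.
by rewrite -lee_fin EFinM -nuE fineK.
Qed.

End GibbsOfBound.

(** * Assembly: the cylinder bound, its transfer to holonomies, the constant 1 and the density *)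

Theorem corollary4p10 (R : realType) (A B : finType)
    (X : shiftSpace A) (Y : shiftSpace B)
    (X_sft : finite_type X) (X_irr : irreducible X)
    (Y_sofic : sofic Y) (Y_irr : irreducible Y)
    (pi : factorCode X Y) (pi_fin : finite_to_one pi)
    (f : Y -> R) (f_sv : summable_variation f)
    (mu : probability (borel X) R)
    (mu_inv : shift_invariant mu)
    (mu_gibbs : gibbs_for_potential (fun x : X => f (pi x)) mu) :
  gibbs_for_potential f (factor_image pi mu).
Proof.
have [w [W fw]] := modulus_exists f_sv.
have [c c0 hc] := cylinder_bound X_sft X_irr pi_fin fw mu_inv mu_gibbs.
have inv := factor_image_invariant pi mu_inv.
apply: (gibbs_of_holonomy_bound fw); first by case: f_sv.
by apply: (holonomy_bound1 fw inv); exact: cylinder_holonomy_bound c0 hc.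
Qed.
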